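(* Let $X$ be a Polish space, $Y$ a separable metrizable space, and $f:X\to Y$. Then $f^{-1}(A)$ is ${\bf\Sigma}^0_3$ in $X$ for every ${\bf\Sigma}^0_3$ set $A\subseteq Y$ if and only if $f\in{\rm dec}({\bf\Sigma}^0_1,{\bf\Delta}^0_3)$.
   Context: $f\in{\rm dec}({\bf\Sigma}^0_1,{\bf\Delta}^0_3)$ means there is a partition $(X_k)_{k<\omega}$ of $X$ into countably many ${\bf\Delta}^0_3$ subsets of $X$ such that each restriction $f\upharpoonright X_k$ is continuous (with respect to the subspace topology on $X_k$). *)

(* Defs.v *)
From mathcomp Require Import all_boot all_order all_algebra.
From mathcomp Require Import all_classical all_reals all_analysis.

Set Implicit Arguments.
Unset Strict Implicit.
Unset Printing Implicit Defensive.

Import Order.TTheory GRing.Theory Num.Theory.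
Local Open Scope classical_set_scope.
Local Open Scope ring_scope.

(* Nonnegativity of [d] follows from the other axioms.  The last clause says
   that the open [d]-balls form neighbourhood bases for the topology of [T]. *)
Definition compatible_metric (R : realType) (T : topologicalType)
    (d : T -> T -> R) : Prop :=
  [/\ forall x y, d x y = 0 <-> x = y,
      forall x y, d x y = d y x,
      forall x y z, d x z <= d x y + d y z &
      forall x : T, nbhs x = nbhs_ball_ (fun y e => [set z | d y z < e]) x].

(* [cauchy] and [complete] of the library are about uniform structures; here
   the topology is given and the metric varies. *)
Definition complete_metric (R : realType) (T : topologicalType)
    (d : T -> T -> R) : Prop :=
  forall u : nat -> T,
    (forall e : R, 0 < e ->
       exists N, forall m n, (N <= m)%N -> (N <= n)%N -> d (u m) (u n) < e) ->
    exists l : T, u @ \oo --> l.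

Definition separable (T : topologicalType) : Prop :=
  exists2 D : set T, countable D & dense D.

Definition separable_metrizable (R : realType) (T : topologicalType) : Prop :=
  separable T /\ exists d : T -> T -> R, compatible_metric d.

Definition polish (R : realType) (T : topologicalType) : Prop :=
  separable T /\
  exists2 d : T -> T -> R, compatible_metric d & complete_metric d.

(* Finite levels of the (boldface) Borel hierarchy, with the usual indexing from
   1 (level 0 is empty): a set of class [Sigma0 n] with n > 1 is a countable
   union of sets [F i] of class [Pi0 (k i)], where 1 <= k i < n. *)
Inductive Sigma0 (T : topologicalType) : nat -> set T -> Prop :=
| Sigma0_open (U : set T) : open U -> Sigma0 1 U
| Sigma0_bigcup (n : nat) (k : nat -> nat) (F : nat -> set T) :
    (forall i, (0 < k i < n)%N) ->
    (forall i, Sigma0 (k i) (~` F i)) ->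
    Sigma0 n (\bigcup_i F i).

Definition Pi0 (T : topologicalType) (n : nat) (A : set T) : Prop :=
  Sigma0 n (~` A).

Definition Delta0 (T : topologicalType) (n : nat) (A : set T) : Prop :=
  Sigma0 n A /\ Pi0 n A.

(* dec(Sigma^0_1, Delta^0_n).  Pieces may be empty, so that finite partitions
   are included; this is why the library's [partition] is not used. *)
Definition dec_Sigma1_Delta (X Y : topologicalType) (n : nat) (f : X -> Y) :
    Prop :=
  exists P : nat -> set X,
    [/\ cover [set: nat] P = [set: X],
        trivIset [set: nat] P,
        forall k, Delta0 n (P k) &
        forall k, {within P k, continuous f}].

(* Main.v *)
Require Import Defs.
From mathcomp Require Import all_boot all_order all_algebra.
From mathcomp Require Import all_classical all_reals all_analysis.
From mathcomp Require Import borel_hierarchy lra zify.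
From Stdlib Require Lists.List.

(** Call a set small when it is covered by countably many G_delta sets on each
    of which [f] is continuous.  If the whole space is small, disjointifying the
    cover gives the decomposition.  Otherwise we find a G_delta set [A] whose
    preimage is not Sigma^0_3.

    Below every non-small G_delta set there is a "wild" one: [H] with a dense
    G_delta subset [Hs] on which [f] is continuous, such that on every nonempty
    relatively open subset of [H] the points at which [f] is not the limit of
    [f | Hs] form a non-small set ([wild_subset]).  So near any point of [H]
    there are an open [V] and a wild [H'] inside [H], with [f] mapping [H'] into
    [V], such that points of [Hs] with values outside the closure of [V]
    accumulate at every point of [H'].

    Iterating, one grows a tree of points of [X] indexed by finite 0-1 words.
    One successor opens a new node [(H', Hs', V')] below the current node; the
    other one is a point of the set [Hs] of the parent node.  A new [V'] must
    contain no value of an older point, and older points must still be able to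
    return; this rules out only finitely many values ([finite_bad_values]), and
    preimages of points are small.  Let [A] be the set of points lying in [V]
    for infinitely many nodes.  The limit along a branch has its value in [A] if
    and only if the depth of the branch tends to infinity, which is not a
    Sigma^0_3 condition on the branch. *)

Set Implicit Arguments.
Unset Strict Implicit.
Unset Printing Implicit Defensive.

Import Order.TTheory GRing.Theory Num.Theory.
Local Open Scope classical_set_scope.
Local Open Scope ring_scope.

(** * Metrizable spaces *)

Section Topology.
Variable T : topologicalType.
Implicit Types (A B O : set T) (x : T).

Lemma closureOP A x :
  closure A x <-> forall O, open O -> O x -> exists2 y, A y & O y.
Proof.
split=> [cx O oO Ox|h B].
  by have [y [Ay Oy]] := cx O (open_nbhs_nbhs (conj oO Ox)); exists y.
rewrite nbhsE => -[ O [oO Ox] OB]; have [y Ay Oy] := h O oO Ox.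
by exists y; split=> //; exact: OB.
Qed.

Lemma open_setCclosure A : open (~` closure A).
Proof. by rewrite openC; exact: closed_closure. Qed.

Lemma Gdelta_bigcap (A : nat -> set T) :
  (forall n, Gdelta (A n)) -> Gdelta (\bigcap_n A n).
Proof.
move=> gA; have /choice[U hU] : forall n : nat,
    exists U : nat -> set T, (forall i, open (U i)) /\ A n = \bigcap_i U i.
  by move=> n; have [U] := gA n; exists U.
have oU n i : open (U n i) by case: (hU n).
exists (fun k => if unpickle k is Some (n, i) then U n i else setT).
  by move=> k; case: (unpickle k) => [[n i]|]; [exact: oU|exact: openT].
apply/seteqP; split=> x h.
  move=> k _; case: (unpickle k) => [[n i]|] //.
  by have := h n I; case: (hU n) => _ ->; exact.
move=> n _; case: (hU n) => _ -> i _.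
by have := h (pickle (n, i)) I; rewrite pickleK.
Qed.

Lemma GdeltaI A B : Gdelta A -> Gdelta B -> Gdelta (A `&` B).
Proof.
move=> gA gB; have -> : A `&` B = \bigcap_n (if n is 0 then A else B).
  apply/seteqP; split=> [x [Ax Bx] [|n] _ //|x h].
  by split; [exact: (h 0%N)|exact: (h 1%N)].
by apply: Gdelta_bigcap => -[].
Qed.

Lemma Gdelta0 : Gdelta (set0 : set T).
Proof. by apply: open_Gdelta; exact: open0. Qed.

Lemma GdeltaT : Gdelta (setT : set T).
Proof. by apply: open_Gdelta; exact: openT. Qed.

(** Numbers that code no pair get the empty set, which has every property later asked of the
    pieces. *)
Lemma pairing_cover (A : nat -> nat -> set T) : exists B : nat -> set T,
  (forall k, B k = set0 \/ exists n i, B k = A n i) /\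
  \bigcup_k B k = \bigcup_n \bigcup_i A n i.
Proof.
exists (fun k => if unpickle k is Some (n, i) then A n i else set0); split.
  move=> k; case: (unpickle k) => [[n i]|]; last by left.
  by right; exists n, i.
apply/seteqP; split=> [x [k _]|x [n _ [i _ h]]].
  by case: (unpickle k) => [[n i]|] // h; exists n => //; exists i.
by exists (pickle (n, i)) => //; rewrite pickleK.
Qed.

End Topology.

Section Metric.
Variables (R : realType) (T : topologicalType) (d : T -> T -> R).
Hypothesis hd : compatible_metric d.
Implicit Types (A O : set T) (x y z : T).

Lemma dist_xx x : d x x = 0. Proof. by case: hd => h _ _ _; apply/h. Qed.

Lemma dist_eq0 x y : d x y = 0 -> x = y.
Proof. by case: hd => h _ _ _ /h. Qed.

Lemma dist_sym x y : d x y = d y x. Proof. by case: hd. Qed.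

Lemma dist_tri x y z : d x z <= d x y + d y z. Proof. by case: hd. Qed.

Lemma dist_ge0 x y : 0 <= d x y.
Proof.
have := dist_tri x y x; rewrite dist_xx (dist_sym y x) -mulr2n.
by rewrite pmulrn_lge0.
Qed.

Lemma nbhs_distP x A :
  nbhs x A <-> exists2 e, 0 < e & forall z, d x z < e -> A z.
Proof.
case: hd => _ _ _ ->; rewrite /nbhs_ball_ /filter_from /=.
by split=> -[e e0 h]; exists e => // z /h.
Qed.

Lemma open_dball x e : open [set z | d x z < e].
Proof.
rewrite openE => z /= xz; apply/nbhs_distP; exists (e - d x z).
  by rewrite subr_gt0.
by move=> w zw /=; have := dist_tri x z w; lra.
Qed.

Lemma open_distP O x : open O -> O x ->
  exists2 e, 0 < e & forall z, d x z < e -> O z.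
Proof. by move=> oO Ox; apply/nbhs_distP/open_nbhs_nbhs. Qed.

Lemma closure_dball x y e : closure [set z | d x z < e] y -> d x y <= e.
Proof.
move=> /closureOP h; rewrite leNgt; apply/negP => exy.
have [|z /= xz yz] := h _ (open_dball y (d x y - e)).
  by rewrite /= dist_xx subr_gt0.
by have := dist_tri x z y; rewrite (dist_sym z y); lra.
Qed.

Lemma small_inv (e : R) : 0 < e -> exists n : nat, n.+1%:R^-1 < e.
Proof.
move=> e0; have [N _ /(_ N (leqnn N)) h] := near_infty_natSinv_lt (PosNum e0).
by exists N.
Qed.

Lemma regular_dist O x : open O -> O x ->
  forall e, 0 < e -> exists O' : set T,
  [/\ open O', O' x, closure O' `<=` O &
    forall y z, O' y -> O' z -> d y z < e].
Proof.
move=> oO Ox e e0; have [r r0 rO] := open_distP oO Ox.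
pose q := Num.min (r / 2) (e / 2).
have q0 : 0 < q by rewrite /q lt_min; apply/andP; split; lra.
have qr : q < r by rewrite /q gt_min; apply/orP; left; lra.
have qe : q <= e / 2 by rewrite /q ge_min lexx orbT.
exists [set z | d x z < q]; split.
- exact: open_dball.
- by rewrite /= dist_xx.
- by move=> y /closure_dball yq; apply: rO; lra.
- by move=> y z /= xy xz; have := dist_tri y x z; rewrite (dist_sym y x); lra.
Qed.

Lemma closed_Gdelta A : closed A -> Gdelta A.
Proof.
move=> cA.
exists (fun n => \bigcup_(x in A) [set z | d x z < n.+1%:R^-1]).
  by move=> n; apply: bigcup_open => x _; exact: open_dball.
apply/seteqP; split=> [x Ax n _|x h].
  by exists x => //=; rewrite dist_xx invr_gt0.
rewrite (closure_id A).1 //; apply/closureOP => O oO Ox.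
have [e e0 eO] := open_distP oO Ox; have [n ne] := small_inv e0.
have [y Ay /= yx] := h n I; exists y => //; apply: eO.
by rewrite dist_sym (lt_trans yx).
Qed.

Lemma closed_set1 x : closed [set x].
Proof.
rewrite -openC openE => y /= yx; apply/nbhs_distP; exists (d x y).
  rewrite lt_neqAle dist_ge0 andbT; apply/eqP => /esym /dist_eq0 xy.
  exact/yx/esym.
by move=> z yz /= zx; move: yz; rewrite zx dist_sym ltxx.
Qed.

Lemma countable_regular_base : separable T -> exists B : nat -> set T,
  (forall n, open (B n)) /\
  forall O x, open O -> O x -> exists n, B n x /\ closure (B n) `<=` O.
Proof.
case=> D /countable_injP[g ginj] dD.
(* Since [g] is injective on [D], this is a single ball, or the empty set when [i] codes no point of
   [D]. *)
pose W i n := \bigcup_(q in [set q | D q /\ g q = i])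
  [set z | d q z < n.+1%:R^-1].
exists (fun k => if unpickle k is Some (i, n) then W i n else set0); split.
  move=> k; case: (unpickle k) => [[i n]|]; last exact: open0.
  by apply: bigcup_open => q _; exact: open_dball.
move=> O x oO Ox; have [e e0 eO] := open_distP oO Ox.
have e20 : 0 < e / 2 by lra.
have [n ne] := small_inv e20.
have n0 : 0 < n.+1%:R^-1 :> R by rewrite invr_gt0.
have [||q [/= xq Dq]] := dD [set z | d x z < n.+1%:R^-1].
  by exists x; rewrite /= dist_xx.
  exact: open_dball.
exists (pickle (g q, n)); rewrite pickleK.
have Wq y : W (g q) n y <-> d q y < n.+1%:R^-1.
  split=> [[p [/= Dp gp]] pqy|h]; last by exists q.
  by have <- : p = q; [apply: ginj => //; rewrite inE|].
split; first by apply/Wq; rewrite dist_sym.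
move=> y cy; apply: eO; have : closure [set z | d q z < n.+1%:R^-1] y.
  by move: y cy; apply: closureS => y /Wq.
move=> /closure_dball qy; have := dist_tri x q y.
by move: (le_lt_trans qy ne) (lt_trans xq ne); lra.
Qed.

(** Cantor's intersection argument: points chosen in the [O n] form a Cauchy sequence, and its limit
    lies in the closure of each [O n.+1], hence in [O n]. *)
Lemma nested_open_point (O : nat -> set T) : complete_metric d ->
  (forall n, O n !=set0) -> (forall n, closure (O n.+1) `<=` O n) ->
  (forall e, 0 < e -> exists n, forall y z, O n y -> O n z -> d y z < e) ->
  exists x, forall n, O n x.
Proof.
move=> cd /choice[u Ou] cO sO.
have dO m n : (m <= n)%N -> O n `<=` O m.
  move=> /subnK <-; elim: (n - m)%N => // k IH x /subset_closure.
  by rewrite addSn => /cO /IH.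
have [e e0|l ul] := cd u.
  have [N hN] := sO e e0; exists N => m n Nm Nn.
  by apply: hN; [exact: (dO _ _ Nm)|exact: (dO _ _ Nn)].
exists l => n; apply: cO; apply/closureOP => U oU Ul.
have /ul [N _ hN] : nbhs l U by exact: open_nbhs_nbhs.
exists (u (maxn N n.+1)); last by apply: hN; rewrite /= leq_maxl.
by apply: (dO _ (maxn N n.+1)); [rewrite leq_maxr|exact: Ou].
Qed.

(** * Borel classes up to level three *)

Lemma Sigma0_inv n A : Sigma0 n A -> n = 1%N /\ open A \/
  exists (k : nat -> nat) (F : nat -> set T),
    [/\ forall i, (0 < k i < n)%N, forall i, Sigma0 (k i) (~` F i) &
      A = \bigcup_i F i].
Proof. by case=> [U oU|m k F hk hF]; [left|right; exists k, F]. Qed.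

Lemma Sigma0_1P A : Sigma0 1 A -> open A.
Proof.
case/Sigma0_inv => [[]//|[k [F [hk _ _]]]].
by have := hk 0%N; case: (k 0%N) => [|[]].
Qed.

Lemma Sigma0_2P A : Sigma0 2 A -> Fsigma A.
Proof.
case/Sigma0_inv => [[]//|[k [F [hk hF ->]]]]; exists F => // i.
have := hF i; have : k i = 1%N by have := hk i; case: (k i) => [|[|[]]].
by move=> -> /Sigma0_1P; rewrite openC.
Qed.

Lemma setC_Fsigma A : Fsigma (~` A) <-> Gdelta A.
Proof.
split=> -[F cF eF].
  by exists (fun n => ~` F n) => [n|]; [rewrite openC|rewrite -setC_bigcup -eF setCK].
by exists (fun n => ~` F n) => [n|]; [rewrite closedC|rewrite -setC_bigcap -eF].
Qed.

(** The pieces of a Sigma^0_3 set are closed or G_delta; in a metrizable space the closed ones are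
    G_delta too. *)
Lemma Sigma0_3P A : Sigma0 3 A <->
  exists P : nat -> set T, (forall i, Gdelta (P i)) /\ A = \bigcup_i P i.
Proof.
split=> [|[P [gP ->]]].
  case/Sigma0_inv => [[]//|[k [F [hk hF ->]]]]; exists F; split=> // i.
  have := hF i; have := hk i; case: (k i) => [|[|[|]]] // _.
    by move/Sigma0_1P; rewrite openC => /closed_Gdelta.
  by move/Sigma0_2P/setC_Fsigma.
apply: (@Sigma0_bigcup _ _ (fun=> 2%N)) => // i.
have /setC_Fsigma[F cF ->] := gP i.
apply: (@Sigma0_bigcup _ _ (fun=> 1%N)) => // j.
by apply: Sigma0_open; rewrite openC.
Qed.

Lemma Sigma0_3_bigcup (A : nat -> set T) :
  (forall n, Sigma0 3 (A n)) -> Sigma0 3 (\bigcup_n A n).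
Proof.
move=> hA; have /choice[P hP] := fun n => (Sigma0_3P (A n)).1 (hA n).
have [Q [hQ eQ]] := pairing_cover P; apply/Sigma0_3P; exists Q; split.
  move=> k; case: (hQ k) => [->|[n [i ->]]]; first exact: Gdelta0.
  by case: (hP n).
by rewrite eQ; apply: eq_bigcupr => n _; case: (hP n).
Qed.

Lemma Sigma0_3I A B : Sigma0 3 A -> Sigma0 3 B -> Sigma0 3 (A `&` B).
Proof.
move=> /Sigma0_3P[P [gP ->]] /Sigma0_3P[Q [gQ ->]].
rewrite setI_bigcupl; apply: Sigma0_3_bigcup => i.
rewrite setI_bigcupr; apply: Sigma0_3_bigcup => j.
apply/Sigma0_3P; exists (fun=> P i `&` Q j).
by split=> [_|]; [exact: GdeltaI|rewrite bigcup_const].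
Qed.

Lemma Gdelta_Delta0_3 A : Gdelta A -> Delta0 3 A.
Proof.
move=> gA; split.
  by apply/Sigma0_3P; exists (fun=> A); split=> //; rewrite bigcup_const.
have /setC_Fsigma[F cF eF] := gA; rewrite /Pi0 eF.
by apply/Sigma0_3P; exists F; split=> // i; exact: closed_Gdelta.
Qed.

Lemma Delta0_3I A B : Delta0 3 A -> Delta0 3 B -> Delta0 3 (A `&` B).
Proof.
move=> [sA pA] [sB pB]; split; first exact: Sigma0_3I.
rewrite /Pi0 setCI.
have -> : ~` A `|` ~` B = \bigcup_k (if k is 0 then ~` A else ~` B).
  by apply/seteqP; split=> [x [h|h]|x [[|k] _ h]];
    [exists 0%N|exists 1%N|left|right].
by apply: Sigma0_3_bigcup => -[].
Qed.

Lemma Delta0_3C A : Delta0 3 A -> Delta0 3 (~` A).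
Proof. by case=> sA pA; split=> //; rewrite /Pi0 setCK. Qed.

(** The Delta^0_3 sets form an algebra containing the G_delta sets, so disjointifying a G_delta
    cover does not leave the class. *)
Lemma Delta0_3_seqDU (P : nat -> set T) :
  (forall i, Gdelta (P i)) -> forall n, Delta0 3 (seqDU P n).
Proof.
move=> gP n; rewrite /seqDU setDE.
apply: Delta0_3I; first exact: Gdelta_Delta0_3.
elim: n => [|m IH]; first by rewrite big_ord0 setC0; exact: Gdelta_Delta0_3 (GdeltaT _).
rewrite big_ord_recr /= setCU; apply: Delta0_3I => //.
exact/Delta0_3C/Gdelta_Delta0_3.
Qed.

End Metric.

(** * Baire category and generic continuity *)

Lemma dependent_choice_stages (D : Type) (P : nat -> D -> Prop)
    (Q : nat -> D -> D -> Prop) :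
  (exists x, P 0%N x) ->
  (forall n x, P n x -> exists y, P n.+1 y /\ Q n x y) ->
  exists a : nat -> D, forall n, P n (a n) /\ Q n (a n) (a n.+1).
Proof.
move=> [x0 Px0] h.
have /choice[F hF] : forall nx : nat * D, exists y,
    P nx.1 nx.2 -> P nx.1.+1 y /\ Q nx.1 nx.2 y.
  move=> [n x] /=; case: (pselect (P n x)) => [/h[y hy]|nP]; first by exists y.
  by exists x.
pose a := fix a n := if n is n'.+1 then F (n', a n') else x0.
have Pa n : P n (a n) by elim: n => //= n IH; case: (hF (n, a n)).
by exists a => n; split=> //; case: (hF (n, a n)) => //=.
Qed.

Definition regular_base (T : topologicalType) (B : nat -> set T) : Prop :=
  (forall n, open (B n)) /\
  forall O x, open O -> O x -> exists n, B n x /\ closure (B n) `<=` O.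

Lemma Gdelta_forall (T : topologicalType) (J : countType) (D : J -> set T) :
  (forall i, open (D i)) -> Gdelta [set x | forall i, D i x].
Proof.
move=> oD; exists (fun k => if unpickle k is Some i then D i else setT).
  by move=> k; case: (unpickle k) => [i|]; [exact: oD|exact: openT].
apply/seteqP; split=> [x h k _|x h i]; first by case: (unpickle k).
by have := h (pickle i) I; rewrite pickleK.
Qed.

Section Baire.
Variables (R : realType) (X : topologicalType) (d : X -> X -> R).
Hypotheses (hd : compatible_metric d) (cd : complete_metric d).

(** Baire's theorem relative to [G], without a new metric on [G]: the nested neighbourhoods, centred
    at points of [G], also shrink into the open sets whose intersection is [G]. *)
Lemma Gdelta_Baire (J : countType) (G : set X) (D : J -> set X) :
  Gdelta G -> (forall i, open (D i)) ->
  (forall i, G `<=` closure (G `&` D i)) ->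
  G `<=` closure [set x | G x /\ forall i, D i x].
Proof.
move=> [U oU eG] oD dD x Gx; apply/closureOP => O oO Ox.
pose D' n := if unpickle n is Some i then D i else setT.
have oD' n : open (D' n).
  by rewrite /D'; case: (unpickle n) => [i|]; [exact: oD|exact: openT].
have dD' n : G `<=` closure (G `&` D' n).
  rewrite /D'; case: (unpickle n) => [i|]; first exact: dD.
  by rewrite setIT; exact: subset_closure.
have [|n [A y] /= [oA Ay Gy AO]|a ha] := @dependent_choice_stages (set X * X)
  (fun _ p => [/\ open p.1, p.1 p.2, G p.2 & p.1 `<=` O])
  (fun n p q => [/\ closure q.1 `<=` p.1, q.1 `<=` D' n `&` U n &
     forall y z, q.1 y -> q.1 z -> d y z < n.+1%:R^-1]).
- by exists (O, x); split=> /=.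
- have /closureOP/(_ A oA Ay)[z [Gz Dz] Az] := dD' n _ Gy.
  have [A' [oA' Az' cA' sA']] : exists A', [/\ open A', A' z,
      closure A' `<=` A `&` (D' n `&` U n) &
      forall y z, A' y -> A' z -> d y z < n.+1%:R^-1].
    apply: (regular_dist hd).
    - by apply: openI => //; apply: openI.
    - by split=> //; split=> //; move: Gz; rewrite eG; exact.
    - by rewrite invr_gt0.
  exists (A', z) => /=; split; split=> //.
  - by move=> w /subset_closure /cA'[/AO].
  - by move=> w /cA'[].
  - by move=> w /subset_closure /cA'[].
have [| | |y hy] := nested_open_point cd (O := fun n => (a n).1).
- by move=> n; exists (a n).2; case: (ha n) => -[].
- by move=> n; case: (ha n) => _ [].
- move=> e e0; have [n ne] := small_inv e0; exists n.+1 => y z ay az.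
  by case: (ha n) => _ [_ _ /(_ y z ay az) h]; exact: lt_trans ne.
exists y; last by case: (ha 0%N) => -[_ _ _ AO] _; exact/AO/hy.
split; first by rewrite eG => n _; case: (ha n) => _ [_ /(_ y (hy _))[]].
move=> j; case: (ha (pickle j)) => _ [_ /(_ y (hy _))[] + _ _].
by rewrite /D' pickleK.
Qed.

End Baire.

Section GenericContinuity.
Variables (R : realType) (X Y : topologicalType).
Variables (dX : X -> X -> R) (f : X -> Y) (BX : nat -> set X) (BY : nat -> set Y).
Hypotheses (hdX : compatible_metric dX) (cdX : complete_metric dX).
Hypotheses (hBX : regular_base BX) (hBY : regular_base BY).

Definition cont_on (P : set X) : Prop := forall x, P x ->
  forall V, open V -> V (f x) ->
  exists O, [/\ open O, O x & forall u, O u -> P u -> V (f u)].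

Lemma cont_onS (P Q : set X) : P `<=` Q -> cont_on Q -> cont_on P.
Proof.
move=> PQ cQ x /PQ Qx V oV Vx; have [ O [oO Ox h]] := cQ x Qx V oV Vx.
by exists O; split=> // u Ou /PQ; exact: h.
Qed.

(* On the comeager set [forall j, D j x], the countable union of the [P i] is
   open around every point near which one of the [P i] is dense in [G]. *)
Lemma locally_dense_Gdelta (G : set X) (P : nat -> set X) :
  (forall i, Gdelta (P i)) ->
  exists D : nat * nat * nat -> set X,
  [/\ forall j, open (D j), forall j, G `<=` closure (G `&` D j) &
    forall x, G x -> (forall j, D j x) ->
    forall n i, BX n x -> BX n `&` G `<=` closure (P i `&` G) -> P i x].
Proof.
move=> gP; have /choice[U hU] : forall i : nat,
    exists U : nat -> set X, (forall k, open (U k)) /\ P i = \bigcap_k U k.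
  by move=> i; have [U] := gP i; exists U.
(* The complement of the closure makes [D j] dense in [G]; at points of [BX n] in [G] it is void,
   and membership in [U i k] is forced. *)
pose D (j : nat * nat * nat) : set X := let: (n, i, k) := j in
  if `[< BX n `&` G `<=` closure (P i `&` G) >]
  then U i k `|` ~` closure (BX n `&` G) else setT.
exists D; split.
- move=> [[n i] k] /=; case: ifP => _; last exact: openT.
  by apply: openU; [exact: (hU i).1|exact: open_setCclosure].
- move=> [[n i] k] x Gx /=; case: ifP => [/asboolP h|_]; last first.
    by rewrite setIT; exact: subset_closure.
  apply/closureOP => O oO Ox.
  case: (pselect (closure (BX n `&` G) x)) => [|nx]; last first.
    by exists x => //; split=> //; right.
  move=> /closureOP/(_ O oO Ox)[y By Oy].
  have /closureOP/(_ O oO Oy)[z [Pz Gz] Oz] := h y By.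
  exists z => //; split=> //; left; move: Pz; rewrite (hU i).2; exact.
- move=> x Gx Dx n i Bx h; rewrite (hU i).2 => k _.
  have := Dx (n, i, k); rewrite /= ifT; last exact/asboolP.
  by case=> // /(_ _)[]; apply: subset_closure.
Qed.

(** Otherwise the complements of the closures of the [P i] would be dense in [G] inside [O], and by
    Baire some point there would lie in no [P i]. *)
Lemma dense_somewhere (G : set X) (P : nat -> set X) (O : set X) (x : X) :
  Gdelta G -> open O -> O x -> G x ->
  (forall y, G y -> O y -> exists i, P i y) ->
  exists n i, [/\ BX n `<=` O, exists2 y, BX n y & G y &
    BX n `&` G `<=` closure (P i `&` G)].
Proof.
move=> gG oO Ox Gx hP; apply: contrapT => hn.
have dD i : O `&` G `<=` closure ((O `&` G) `&` ~` closure (P i `&` G)).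
  move=> y [Oy Gy]; apply/closureOP => A oA Ay.
  have [n [Bny BnA]] := hBX.2 _ y (openI oO oA) (conj Oy Ay).
  apply: contrapT => hy; apply: hn; exists n, i; split.
  - by move=> z /subset_closure /BnA[].
  - by exists y.
  - move=> z [Bz Gz]; apply: contrapT => nz; apply: hy.
    by have [Oz Az] := BnA _ (subset_closure Bz); exists z.
have gOG : Gdelta (O `&` G) by apply: GdeltaI => //; exact: open_Gdelta.
have /closureOP/(_ O oO Ox)[y [[Oy Gy] hy] _] :=
  Gdelta_Baire hdX cdX gOG (fun i => @open_setCclosure _ _) dD (conj Ox Gx).
have [i Pi] := hP y Gy Oy.
by apply: (hy i); apply: subset_closure.
Qed.

Hypothesis hf : forall A, Gdelta A -> exists P : nat -> set X,
  (forall i, Gdelta (P i)) /\ f @^-1` A = \bigcup_i P i.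
Hypothesis closed_Gdelta_Y : forall A : set Y, closed A -> Gdelta A.

(** [V] and its complement are both G_delta, so both preimages are countable unions of G_delta sets.
    The regions where some piece is dense in [G] together form a dense open set (index [None]), and
    generically the piece that is dense near a point decides whether its value is in [V]. *)
Lemma preimage_open_comeager (G : set X) (V : set Y) : Gdelta G -> open V ->
  exists (D : option (bool * (nat * nat * nat)) -> set X) (W : set X),
  [/\ forall j, open (D j), forall j, G `<=` closure (G `&` D j), open W &
    forall x, G x -> (forall j, D j x) -> (V (f x) <-> W x)].
Proof.
move=> gG oV; have [P [gP eP]] := hf (open_Gdelta oV).
have [|Q [gQ eQ]] := hf (closed_Gdelta_Y (A := ~` V) _); first by rewrite closedC.
have [D1 [oD1 dD1 hD1]] := locally_dense_Gdelta G gP.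
have [D2 [oD2 dD2 hD2]] := locally_dense_Gdelta G gQ.
pose W (S : nat -> set X) :=
  \bigcup_(n in [set n | exists i, BX n `&` G `<=` closure (S i `&` G)]) BX n.
have oW S : open (W S) by apply: bigcup_open => n _; exact: hBX.1.
exists (fun j => match j with
  | None => W P `|` W Q | Some (true, j) => D1 j | Some (false, j) => D2 j end), (W P).
split=> //.
- by move=> [[[] j]|] //; exact: openU.
- move=> [[[] j]|] //= x Gx; apply/closureOP => O oO Ox.
  (* The two covers are interleaved: odd indices for the preimage of [V], even ones for that of its
     complement. *)
  have [|n [i [BnO [y By Gy] h]]] := @dense_somewhere G
      (fun i => if odd i then P i./2 else Q i./2) O x gG oO Ox Gx.
    move=> y Gy _; case: (pselect (V (f y))) => [|] Vy.
      have : (f @^-1` V) y by [].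
      by rewrite eP => -[i _ h]; exists i.*2.+1; rewrite /= odd_double /= uphalf_double.
    have : (f @^-1` (~` V)) y by [].
    by rewrite eQ => -[i _ h]; exists i.*2; rewrite odd_double doubleK.
  exists y; last exact: BnO.
  split=> //; move: h; case: ifP => _ h; [left|right]; exists n => //; by exists i./2.
- move=> x Gx Dx; split=> [Vx|[n [i h] Bn]].
    case: (Dx None) => // -[n [i h] Bn].
    have : (f @^-1` (~` V)) x.
      rewrite eQ; exists i => //; apply: (hD2 x Gx _ n) => // j.
      exact: (Dx (Some (false, j))).
    by [].
  have : (f @^-1` V) x.
    rewrite eP; exists i => //; apply: (hD1 x Gx _ n) => // j.
    exact: (Dx (Some (true, j))).
  by [].
Qed.

(** On the intersection of the comeager sets belonging to the members of a countable base of [Y],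
    every basic preimage is relatively open. *)
Lemma generic_continuity (G : set X) : Gdelta G -> exists Gs,
  [/\ Gdelta Gs, Gs `<=` G, G `<=` closure Gs & cont_on Gs].
Proof.
move=> gG.
have /choice[D] := fun m => preimage_open_comeager gG (hBY.1 m).
move=> /choice[W hDW].
pose D' (p : nat * option (bool * (nat * nat * nat))) := D p.1 p.2.
have oD' p : open (D' p) by case: (hDW p.1) => h _ _ _; exact: h.
exists [set x | G x /\ forall p, D' p x]; split.
- by apply: GdeltaI => //; apply: Gdelta_forall.
- by move=> x [].
- by apply: (Gdelta_Baire hdX cdX) => // p; case: (hDW p.1) => _ h _ _; exact: h.
- move=> x [Gx Dx] V oV Vx; have [m [Bm BV]] := hBY.2 _ _ oV Vx.
  have [_ _ oW hW] := hDW m; exists (W m); split=> //.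
    by apply/hW => // j; exact: (Dx (m, j)).
  move=> u Wu [Gu Du]; apply/BV/subset_closure/hW => // j.
  exact: (Du (m, j)).
Qed.

End GenericContinuity.

(** * Small sets and wild sets *)

Section Small.
Variables (X Y : topologicalType) (f : X -> Y).

Definition small (A : set X) : Prop := exists P : nat -> set X,
  [/\ forall n, Gdelta (P n), forall n, cont_on f (P n) &
    A `<=` \bigcup_n P n].

Lemma smallS (A B : set X) : A `<=` B -> small B -> small A.
Proof.
by move=> AB [P [gP cP BP]]; exists P; split=> //; exact: subset_trans BP.
Qed.

Lemma small_bigcup (A : nat -> set X) :
  (forall n, small (A n)) -> small (\bigcup_n A n).
Proof.
move=> /choice[P hP]; have [Q [hQ eQ]] := pairing_cover P.
exists Q; split.
- move=> k; case: (hQ k) => [->|[n [i ->]]]; first exact: Gdelta0.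
  by case: (hP n).
- move=> k; case: (hQ k) => [-> //|[n [i ->]]].
  by case: (hP n).
- rewrite eQ => x [n _ Ax]; have [_ _ h] := hP n.
  by have [i _ Pi] := h x Ax; exists n => //; exists i.
Qed.

Lemma small_cont (P : set X) : Gdelta P -> cont_on f P -> small P.
Proof. by move=> gP cP; exists (fun=> P); split=> // x Px; exists 0%N. Qed.

Lemma small0 : small set0.
Proof. by apply: small_cont; [exact: Gdelta0|]. Qed.

Lemma smallU (A B : set X) : small A -> small B -> small (A `|` B).
Proof.
move=> sA sB; apply: (smallS (B := \bigcup_n (if n is 0 then A else B))).
  by move=> x [h|h]; [exists 0%N|exists 1%N].
by apply: small_bigcup => -[].
Qed.

Lemma small_countable (J : countType) (A : J -> set X) (B : set X) :
  (forall j, small (A j)) -> (forall x, B x -> exists j, A j x) -> small B.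
Proof.
move=> sA BA.
apply: (smallS (B := \bigcup_k (if unpickle k is Some j then A j else set0))).
  by move=> x /BA[j Aj]; exists (pickle j) => //; rewrite pickleK.
by apply: small_bigcup => k; case: (unpickle k) => [j|]; [exact: sA|exact: small0].
Qed.

Definition nowhere_small (G : set X) : Prop :=
  forall O x, open O -> O x -> G x -> ~ small (O `&` G).

End Small.

Section KeyLemma.
Variables (R : realType) (X Y : topologicalType).
Variables (dX : X -> X -> R) (dY : Y -> Y -> R) (f : X -> Y).
Variables (BX : nat -> set X) (BY : nat -> set Y).
Hypotheses (hdX : compatible_metric dX) (cdX : complete_metric dX).
Hypothesis hdY : compatible_metric dY.
Hypotheses (hBX : regular_base BX) (hBY : regular_base BY).
Hypothesis hf : forall A, Gdelta A -> exists P : nat -> set X,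
  (forall i, Gdelta (P i)) /\ f @^-1` A = \bigcup_i P i.

Local Notation small := (small f).
Local Notation nowhere_small := (nowhere_small f).
Local Notation cont_on := (cont_on f).

Lemma small_fiber (y : Y) : small (f @^-1` [set y]).
Proof.
have [P [gP eP]] := hf (closed_Gdelta hdY (closed_set1 hdY (x := y))).
exists P; split=> [//|n|]; last by rewrite eP.
have Py x : P n x -> f x = y.
  by move=> Px; have : (f @^-1` [set y]) x by rewrite eP; exists n.
move=> x Px V oV Vx; exists setT; split=> //; first exact: openT.
by move=> u _ /Py ->; rewrite -(Py x Px).
Qed.

(** As in the Cantor-Bendixson theorem, all basic open sets with a small trace on [G] are removed;
    their union [W] has a small trace as well. *)
Lemma nowhere_small_kernel (G : set X) : Gdelta G -> ~ small G ->
  exists G', [/\ Gdelta G', G' `<=` G, G' !=set0 & nowhere_small G'].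
Proof.
move=> gG nG.
pose W := \bigcup_(n in [set n | small (BX n `&` G)]) BX n.
have sW : small (G `&` W).
  apply: (small_countable (A := fun n : nat =>
    if `[< small (BX n `&` G) >] then BX n `&` G else set0)).
    by move=> n; case: asboolP => // _; exact: small0.
  move=> x [Gx [n /= sn Bn]]; exists n; case: asboolP => //.
have gG' : Gdelta (G `&` ~` W).
  apply: GdeltaI => //; apply: (closed_Gdelta hdX); rewrite closedC.
  by apply: bigcup_open => n _; exact: hBX.1.
exists (G `&` ~` W); split=> //.
- by apply: contrapT => h; apply: nG; apply: smallS sW => x Gx; split=> //;
    apply: contrapT => nW; apply: h; exists x.
- move=> O x oO Ox [Gx nWx] sO; apply: nWx.
  have [n [Bx BO]] := hBX.2 O x oO Ox; exists n => //=.
  apply: smallS (smallU sO sW) => y [By Gy].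
  case: (pselect (W y)) => Wy; [by right|left].
  by split=> //; exact/BO/subset_closure.
Qed.

(** The points of [H] at which [f] is the limit of its restriction to [Hs]. *)
Definition agree (H Hs : set X) : set X := [set x | H x /\
  forall e, 0 < e -> exists O, [/\ open O, O x &
    forall u, O u -> Hs u -> dY (f u) (f x) < e]].

Lemma cont_on_dist (P : set X) x e : cont_on P -> P x -> 0 < e ->
  exists O, [/\ open O, O x & forall u, O u -> P u -> dY (f u) (f x) < e].
Proof.
move=> cP Px e0.
have [|O [oO Ox hO]] := cP x Px _ (open_dball hdY (f x) e).
  by rewrite /= (dist_xx hdY).
by exists O; split=> // u Ou Pu; rewrite (dist_sym hdY); exact: hO.
Qed.

Lemma agree_approx (H Hs : set X) x (e : R) (O : set X) :
  H `<=` closure Hs -> agree H Hs x -> 0 < e -> open O -> O x ->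
  exists u, [/\ O u, Hs u & dY (f u) (f x) < e].
Proof.
move=> dH [Hx ax] e0 oO Ox; have [ O' [oO' O'x h]] := ax e e0.
have /closureOP/(_ _ (openI oO oO') (conj Ox O'x))[u Hu [ Ou O'u]] := dH x Hx.
by exists u; split=> //; exact: h.
Qed.

Lemma agree_cont (H Hs : set X) : H `<=` closure Hs -> cont_on (agree H Hs).
Proof.
move=> dH x [Hx ax] V oV Vx; have [e e0 eV] := open_distP hdY oV Vx.
have [|O [oO Ox h]] := ax (e / 2); first by lra.
exists O; split=> // x' Ox' ax'; apply: eV.
have [|u [ Ou Hu ux']] := agree_approx dH ax' (e := e / 2) _ oO Ox'; first by lra.
have := dist_tri hdY (f x) (f u) (f x'); have := h u Ou Hu.
by rewrite (dist_sym hdY (f x) (f u)); lra.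
Qed.

(** Zero oscillation of [f] along [Hs]. The value of [f] at [x] does not enter, and so, unlike
    [agree], this set is G_delta whenever [H] is. *)
Definition osc0 (H Hs : set X) : set X := [set x | H x /\
  forall e, 0 < e -> exists O, [/\ open O, O x &
    forall u v, O u -> O v -> Hs u -> Hs v -> dY (f u) (f v) < e]].

Lemma osc0_Gdelta (H Hs : set X) : Gdelta H -> Gdelta (osc0 H Hs).
Proof.
move=> gH.
pose W n := \bigcup_(O in [set O : set X | open O /\
  forall u v, O u -> O v -> Hs u -> Hs v -> dY (f u) (f v) < n.+1%:R^-1]) O.
have -> : osc0 H Hs = H `&` [set x | forall n : nat, W n x].
  apply/seteqP; split=> x [Hx h]; split=> //.
    move=> n; have [|O [oO Ox hO]] := h n.+1%:R^-1; first by rewrite invr_gt0.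
    by exists O.
  move=> e e0; have [n ne] := small_inv e0; have [ O [oO hO] Ox] := h n.
  by exists O; split=> // u v Ou Ov Hu Hv; exact: lt_trans (hO u v _ _ _ _) ne.
apply: GdeltaI => //; apply: Gdelta_forall => n.
by apply: bigcup_open => O [].
Qed.

Lemma agree_osc0 (H Hs : set X) : agree H Hs `<=` osc0 H Hs.
Proof.
move=> x [Hx ax]; split=> // e e0.
have [|O [oO Ox h]] := ax (e / 2); first by lra.
exists O; split=> // u v Ou Ov Hu Hv.
have := dist_tri hdY (f u) (f x) (f v); rewrite (dist_sym hdY (f x) (f v)).
by have := h u Ou Hu; have := h v Ov Hv; lra.
Qed.

(* At [t] the limit of [f] along [Gs] exists but differs from the limit of [f]
   along [Hs], so near [t] no point can have both as its value. *)
Lemma agree_disjoint_near (G Gs H Hs : set X) t :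
  G `<=` closure Gs -> H `<=` closure Hs -> cont_on Hs ->
  osc0 G Gs t -> ~ agree G Gs t -> Hs t ->
  exists O, [/\ open O, O t & forall x, O x -> agree G Gs x ->
    agree H Hs x -> False].
Proof.
move=> dG dH cH [Gt ot] nt Ht.
have [e [e0 he]] : exists e, 0 < e /\ forall O, open O -> O t ->
    exists u, [/\ O u, Gs u & e <= dY (f u) (f t)].
  apply: contrapT => hn; apply: nt; split=> // e e0.
  apply: contrapT => hO; apply: hn; exists e; split=> // O oO Ot.
  apply: contrapT => hu; apply: hO; exists O; split=> // u Ou Gu.
  by rewrite ltNge; apply/negP => le; apply: hu; exists u.
(* The way from [f u0] to [f t] through [f u], [f x] and [f w] has legs below e/3, e/6, e/6 and e/3,
   yet the endpoints are at least e apart. *)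
have e3 : 0 < e / 3 by lra.
have e6 : 0 < e / 6 by lra.
have [ O1 [oO1 O1t h1]] := ot _ e3.
have [ O2 [oO2 O2t h2]] := cont_on_dist cH Ht e3.
exists (O1 `&` O2); split=> //; first exact: openI.
move=> x [ O1x O2x] gx hx.
have [u0 [ O1u0 Gu0 u0t]] := he O1 oO1 O1t.
have [u [ O1u Gu ux]] := agree_approx dG gx e6 oO1 O1x.
have [w [ O2w Hw wx]] := agree_approx dH hx e6 oO2 O2x.
have := h1 u0 u O1u0 O1u Gu0 Gu; have := h2 w O2w Hw.
have := dist_tri hdY (f u0) (f u) (f t).
have := dist_tri hdY (f u) (f x) (f t).
have := dist_tri hdY (f x) (f w) (f t).
by rewrite (dist_sym hdY (f x) (f w)); lra.
Qed.

Lemma closed_Gdelta_codomain (A : set Y) : closed A -> Gdelta A.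
Proof. exact: closed_Gdelta hdY _. Qed.

Definition wild (H Hs : set X) : Prop :=
  [/\ [/\ Gdelta H, Gdelta Hs, Hs `<=` H, H `<=` closure Hs & Hs !=set0],
    cont_on Hs &
    forall O x, open O -> O x -> H x -> ~ small (O `&` H `\` agree H Hs)].

(** Let [Gs] be generic in a nowhere small [G]. If this pair is not wild, then inside some [O] the
    points off [agree G Gs] are covered by G_delta sets [S n] of continuity. Some [S n] contains
    many points where the limit along [Gs] exists but is wrong; [H] is the part of [G] in [O] and in
    the closure of such points. Near them the limits along [Gs] and along [S n] differ, so [f]
    cannot agree with both. *)
Lemma wild_subset (G0 : set X) : Gdelta G0 -> ~ small G0 ->
  exists H Hs, wild H Hs /\ H `<=` G0.
Proof.
move=> gG0 /(nowhere_small_kernel gG0)[G [gG GG0 [g Gg] nG]].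
have [Gs [gGs GsG dG cG]] :=
  generic_continuity hdX cdX hBX hBY hf closed_Gdelta_codomain gG.
case: (pselect (forall O x, open O -> O x -> G x ->
    ~ small (O `&` G `\` agree G Gs))) => [hall|].
  exists G, Gs; split=> //; split=> //; split=> //.
  have /closureOP/(_ setT openT I)[u Gu _] := dG g Gg; by exists u.
move=> /existsNP[ O /existsNP[x0 /not_implyP[oO /not_implyP[ Ox0]]]].
move=> /not_implyP[Gx0 /contrapT sE].
have gG1 : Gdelta (O `&` G) by apply: GdeltaI => //; exact: open_Gdelta.
have nG1 : ~ small (O `&` G) by exact: (nG O x0).
have [S [gS cS ES]] := sE.
(* A sigma-ideal generated by closed sets, so that the passage from [T'] to its closure below loses
   nothing. *)
pose J' (A : set X) := exists C : nat -> set X,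
  [/\ forall j, closed (C j), forall j, small (C j `&` (O `&` G)) &
    A `<=` \bigcup_j C j].
have J'cup (A : nat -> set X) : (forall n, J' (A n)) -> J' (\bigcup_n A n).
  move=> /choice[C hC]; have [D [hD eD]] := pairing_cover C; exists D; split.
  - move=> k; case: (hD k) => [->|[n [i ->]]]; first exact: closed0.
    by case: (hC n).
  - move=> k; case: (hD k) => [->|[n [i ->]]]; last by case: (hC n).
    by rewrite set0I; exact: small0.
  - rewrite eD => x [n _ Ax]; have [_ _ h] := hC n.
    by have [i _ Ci] := h x Ax; exists n => //; exists i.
have J'S (A B : set X) : A `<=` B -> J' B -> J' A.
  by move=> AB [C [a b c]]; exists C; split=> //; exact: subset_trans c.
pose T n := S n `&` (O `&` osc0 G Gs `\` agree G Gs).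
(* Otherwise, removing the closed covers of all [T n] from the part of [osc0 G Gs] in [O] leaves a
   G_delta subset of [agree G Gs], and the trace of [G] on [O] becomes small. *)
have [n nT] : exists n, ~ J' (T n).
  apply/existsNP => /J'cup[C [cC sC TC]]; apply: nG1.
  have sM : small ((O `&` osc0 G Gs) `&` ~` \bigcup_j C j).
    apply: small_cont.
      apply: GdeltaI.
        by apply: GdeltaI; [exact: open_Gdelta|exact: osc0_Gdelta].
      rewrite setC_bigcup; apply: Gdelta_bigcap => j.
      by apply: open_Gdelta; rewrite openC.
    apply: (cont_onS _ (agree_cont dG)) => x [[ Ox oscx] nC].
    apply: contrapT => na; apply: nC; apply: TC.
    have [|k _ Sk] := ES x; first by split=> //; split=> //; case: oscx.
    by exists k => //; split=> //; split.
  apply: smallS (smallU (smallU sM sE) (small_bigcup sC)) => x [ Ox Gx].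
  case: (pselect (agree G Gs x)) => [/agree_osc0 ox|]; last by left; right.
  case: (pselect ((\bigcup_j C j) x)) => [[j _ Cj]|nC]; last by left; left.
  by right; exists j.
(* The kernel argument again, now for [J']: no basic open set meeting [T'] has a trace on [T n] that
   lies in [J']. *)
pose W := \bigcup_(m in [set m | J' (T n `&` BX m)]) BX m.
pose T' := T n `\` W.
have sW : J' (T n `&` W).
  apply: (J'S _ (\bigcup_m (if `[< J' (T n `&` BX m) >] then T n `&` BX m else set0))).
    by move=> x [Tx [m /= Jm Bm]]; exists m => //; case: asboolP.
  apply: J'cup => m; case: asboolP => // _; exists (fun=> set0).
  by split=> // j; [exact: closed0|rewrite set0I; exact: small0].
have J'U (A B : set X) : J' A -> J' B -> J' (A `|` B).
  move=> hA hB; apply: (J'S _ (\bigcup_m (if m is 0 then A else B))).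
    by move=> x [h|h]; [exists 0%N|exists 1%N].
  by apply: J'cup => -[].
pose H := (O `&` G) `&` closure T'.
have T'H : T' `<=` S n `&` H.
  move=> x T'x; have [[Sx [[ Ox [Gx _]] _]] _] := T'x.
  by split=> //; split=> //; exact: subset_closure.
have dH : H `<=` closure (S n `&` H).
  by move=> x [_]; apply: closureS.
have gH : Gdelta H.
  by apply: GdeltaI => //; exact: closed_Gdelta hdX _ (@closed_closure _ _).
have cH : cont_on (S n `&` H) by apply: cont_onS (cS n) => x [].
have nH : nowhere_small H.
  move=> O1 x oO1 O1x [_ cx] sO1; have [m [Bx BO1]] := hBX.2 O1 x oO1 O1x.
  have /closureOP/(_ _ (hBX.1 m) Bx)[t T't Bt] := cx.
  case: (T't) => _; apply; exists m => //=.
  have JT' : J' (T' `&` BX m).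
    exists (fun=> closure (BX m) `&` closure T'); split=> [j|j|y [Ty By]].
    - by apply: closedI; exact: closed_closure.
    - by apply: smallS sO1 => y [[/BO1 ? ?] ?]; split.
    - by exists 0%N => //; split; exact: subset_closure.
  apply: J'S (J'U _ _ JT' sW) => y [Ty By].
  by case: (pselect (W y)) => Wy; [right|left].
exists H, (S n `&` H); split; last by move=> x [[_ /GG0]].
split=> //.
  split=> //; [exact: GdeltaI|].
  apply: contrapT => h0; apply: nT; apply: J'S sW => x Tx; split=> //.
  by apply: contrapT => nW; apply: h0; exists x; apply: T'H.
move=> O2 x oO2 O2x [_ cx] sO2.
have /closureOP/(_ O2 oO2 O2x)[t T't O2t] := cx.
have [[St [[ Ot ot] nat]] _] := T't.
have [ O3 [oO3 O3t h3]] := agree_disjoint_near dG dH cH ot nat (T'H t T't).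
(* On [O3] a point of [H] misses one of the two sets [agree], and both exceptional sets are
   small. *)
apply: (nH (O2 `&` O3) t); first exact: openI.
- by split.
- by case: (T'H t T't).
apply: smallS (smallU sO2 sE) => y [[ O2y O3y] Hy].
case: (pselect (agree H (S n `&` H) y)) => [hy|]; last by left.
right; case: (Hy) => OGy _; split=> // gy; exact: (h3 y).
Qed.

End KeyLemma.

(** * Values to avoid *)

Section Scheme.
Variables (R : realType) (X Y : topologicalType).
Variables (dX : X -> X -> R) (dY : Y -> Y -> R) (f : X -> Y).
Variables (BX : nat -> set X) (BY : nat -> set Y).
Hypotheses (hdX : compatible_metric dX) (cdX : complete_metric dX).
Hypothesis hdY : compatible_metric dY.
Hypotheses (hBX : regular_base BX) (hBY : regular_base BY).
Hypothesis hf : forall A, Gdelta A -> exists P : nat -> set X,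
  (forall i, Gdelta (P i)) /\ f @^-1` A = \bigcup_i P i.

Local Notation small := (small f).
Local Notation wild := (wild dY f).
Local Notation In := List.In.

(** The closure of the interior, relative to [H], of the closure of [S]: near [x] the set [S] is
    somewhere dense in [H]. Unlike density, this passes to one part of a finite splitting. *)
Definition large (H S : set X) : set X := [set x | forall O, open O -> O x ->
  exists O', [/\ open O', O' `<=` O, O' `&` H !=set0 & O' `&` H `<=` closure S]].

Lemma largeS (H S S' : set X) : S `<=` S' -> large H S `<=` large H S'.
Proof.
move=> SS' x h O oO Ox; have [ O' [oO' O'O nO' dO']] := h O oO Ox.
by exists O'; split=> //; apply: subset_trans dO' _; exact: closureS.
Qed.

(** A union of two nowhere dense sets is nowhere dense: off the closure of [S] only [S'] can account
    for the density. *)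
Lemma largeU (H S S' : set X) x :
  large H (S `|` S') x -> large H S x \/ large H S' x.
Proof.
move=> h; apply: contrapT => /not_orP[nS nS'].
have hn (A : set X) : ~ large H A x -> exists O, [/\ open O, O x &
    forall O', open O' -> O' `<=` O -> O' `&` H !=set0 ->
      ~ (O' `&` H `<=` closure A)].
  move=> nA; apply: contrapT => hn; apply: nA => O oO Ox.
  apply: contrapT => hO; apply: hn; exists O; split=> // O' oO' O'O nO' dO'.
  by apply: hO; exists O'.
have [ O1 [oO1 O1x h1]] := hn _ nS; have [ O2 [oO2 O2x h2]] := hn _ nS'.
have [ O [oO OO nO dO]] := h _ (openI oO1 oO2) (conj O1x O2x).
have [y [ Oy Hy] ny] : exists2 y, (O `&` H) y & ~ closure S y.
  apply: contrapT => hy; apply: (h1 O oO _ nO) => [z /OO[]//|z Oz].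
  by apply: contrapT => nz; apply: hy; exists z.
apply: (h2 (O `&` ~` closure S)).
- by apply: openI => //; exact: open_setCclosure.
- by move=> z [/OO[]].
- by exists y.
- by move=> z [[ Oz nz] Hz]; have := dO z (conj Oz Hz); rewrite closureU => -[].
Qed.

Lemma large_mem (H : set X) (S : nat -> set X) (J : seq nat) (S0 : set X) x :
  (forall u, S0 u -> exists2 j, j \in J & S j u) -> large H S0 x ->
  exists2 j, j \in J & large H (S j) x.
Proof.
elim: J S0 => [|j J IH] S0 hS hL.
  have [ O [_ _ [y Oy] /(_ y Oy)]] := hL _ openT I.
  by move=> /closureOP/(_ setT openT I)[u /hS[]].
have /largeU[hj|hJ] : large H (S j `|` (S0 `&` ~` S j)) x.
  apply: largeS hL => u S0u.
  by case: (pselect (S j u)) => ?; [left|right].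
  by exists j; rewrite ?mem_head.
have [|i iJ hi] := IH _ _ hJ; last by exists i; rewrite // inE iJ orbT.
move=> u [/hS[i]]; rewrite inE => /orP[/eqP-> //|iJ Si] _.
by exists i.
Qed.

(** The open sets whose intersections are [H] and [Hs] are stored, so that neighbourhoods can shrink
    into them one by one and a limit point lands in the intersection. [nidx] is the number of the
    stage that opened the node. *)
Record node := Node {
  nidx : nat; nU : nat -> set X; nUs : nat -> set X; nV : set Y }.

Definition nH (v : node) : set X := \bigcap_k nU v k.
Definition nHs (v : node) : set X := \bigcap_k nUs v k.

(** The chain runs from the current node to the root. The condition keeps possible, from places near
    [x], a successive return to all its nodes; [B s] holds the values forbidden at the node opened
    by stage [s]. *)
Fixpoint returnable (B : nat -> set Y) (c : seq node) : set X :=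
  if c is v :: c' then
    large (nH v) (nHs v `&` ~` (f @^-1` B (nidx v)) `&` returnable B c')
  else setT.

Lemma returnableS (B B' : nat -> set Y) c :
  (forall v, In v c -> B (nidx v) `<=` B' (nidx v)) ->
  returnable B' c `<=` returnable B c.
Proof.
elim: c => //= v c IH BB'; apply: largeS => x [[Hx nB] rx]; split.
  by split=> // Bx; apply/nB/BB'; [left|].
by apply: IH rx => w wc; apply: BB'; right.
Qed.

Definition addV (B : nat -> set Y) (W : set Y) : nat -> set Y :=
  fun s => B s `|` W.

(** A value lies in at most one [W j], so each node of the chain costs one index; [large_mem] then
    picks one surviving index for a large set of points. *)
Lemma returnable_disjoint (B : nat -> set Y) (W : nat -> set Y) c J x :
  (forall i j y, W i y -> W j y -> i = j) -> uniq J -> (size c < size J)%N ->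
  returnable B c x -> exists2 j, j \in J & returnable (addV B (W j)) c x.
Proof.
move=> dW; elim: c J x => [|v c IH] J x uJ /= sJ.
  by move=> _; case: J uJ sJ => // j J _ _; exists j; rewrite ?mem_head.
apply: large_mem => u [[Hu nBu] ru].
have [j0 hj0] : exists j0, forall j, j \in J -> W j (f u) -> j = j0.
  case: (pselect (exists j, W j (f u))) => [[j0 h0]|h].
    by exists j0 => j _ hj; exact: dW hj h0.
  by exists 0%N => j _ hj; case: h; exists j.
have [|j jJ rj] := IH (rem j0 J) u (rem_uniq _ uJ) _ ru.
  case: (boolP (j0 \in J)) => j0J; last by rewrite rem_id // ltnW.
  by rewrite size_rem // ltn_predRL.
move: jJ; rewrite mem_rem_uniq // !inE => /andP[/eqP jj0 jJ].
exists j => //; split=> //; split=> //.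
by move=> [|/(hj0 j jJ)].
Qed.

Lemma separated_seq (s : seq Y) : uniq s -> exists2 e : R, 0 < e &
  forall y z, y \in s -> z \in s -> dY y z < e -> y = z.
Proof.
elim: s => [|a s IH] /=; first by exists 1.
move=> /andP[as_ /IH[e e0 he]].
have [e' e'0 he'] : exists2 e' : R, 0 < e' & forall z, z \in s -> e' <= dY a z.
  elim: s as_ {IH he} => [|b s IH]; first by exists 1.
  rewrite inE negb_or => /andP[ab /IH[e1 e10 he1]].
  have ab0 : 0 < dY a b.
    rewrite lt_neqAle (dist_ge0 hdY) andbT; apply/eqP => /esym /(dist_eq0 hdY).
    exact/eqP.
  exists (Num.min e1 (dY a b)); first by rewrite lt_min e10.
  move=> z; rewrite inE => /orP[/eqP ->|/he1 h]; first by rewrite ge_min lexx orbT.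
  by rewrite ge_min h.
exists (Num.min e e'); first by rewrite lt_min e0.
move=> y z; rewrite !inE lt_min.
move=> /orP[/eqP ->|ys] /orP[/eqP ->|zs] /andP[h1 h2] //.
- by move: (he' z zs); rewrite leNgt h2.
- by move: (he' y ys); rewrite (dist_sym hdY) leNgt h2.
- exact: he.
Qed.

(** With more bad values than nodes in [c], small closed neighbourhoods of these values would be
    disjoint, against [returnable_disjoint]. *)
Lemma finite_bad_values (B : nat -> set Y) c x : returnable B c x ->
  exists N : seq Y, forall y, y \notin N -> exists V,
    [/\ open V, V y & returnable (addV B (closure V)) c x].
Proof.
move=> rx.
pose bad y := forall V, open V -> V y -> ~ returnable (addV B (closure V)) c x.
have hm m : (exists N : seq Y, forall y, bad y -> y \in N) \/
    exists s : seq Y, [/\ uniq s, size s = m & forall y, y \in s -> bad y].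
  elim: m => [|m [|[s [us ss bs]]]]; [by right; exists [::]|by left|].
  case: (pselect (exists y, bad y /\ y \notin s)) => [[y [by_ ys]]|hn].
    right; exists (y :: s); split=> /=; [by rewrite ys|by rewrite ss|].
    by move=> z; rewrite inE => /orP[/eqP->|/bs].
  left; exists s => y by_; apply: contrapT => /negP ys.
  by apply: hn; exists y.
case: (hm (size c).+1) => [[N hN]|[s [us ss bs]]].
  exists N => y yN; apply: contrapT => hn; move/negP: yN; apply; apply: hN.
  by move=> V oV Vy rV; apply: hn; exists V.
exfalso; have [e e0 he] := separated_seq us.
case: s us ss bs he => // y0 s0; set s := y0 :: s0 => us ss bs he.
(* Distinct values are at least e apart, so closed balls of radius e/3 are disjoint; indices beyond
   the list get the empty set. *)
pose W i := if (i < size s)%N then closure [set z | dY (nth y0 s i) z < e / 3]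
  else set0.
have [| | |//|j] := @returnable_disjoint B W c (iota 0 (size s)) x.
- move=> i j y; rewrite /W; case: ltnP => // il; case: ltnP => // jl.
  move=> /(closure_dball hdY) hi /(closure_dball hdY) hj.
  apply/eqP; rewrite -(nth_uniq y0 il jl us); apply/eqP/he; rewrite ?mem_nth //.
  have := dist_tri hdY (nth y0 s i) y (nth y0 s j).
  by rewrite (dist_sym hdY y (nth y0 s j)); lra.
- exact: iota_uniq.
- by rewrite size_iota ss.
rewrite mem_iota /= add0n /W => jl; rewrite jl => rj.
apply: (bs (nth y0 s j)) rj; first exact: mem_nth.
  exact: open_dball.
by rewrite /= (dist_xx hdY); lra.
Qed.

Record stage := Stage { pt : X; nb : set X; sV : set Y; ch : seq node }.

(** The third clause allows a return to the parent of [v], the fourth the opening of a node below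
    [v]. *)
Definition good_stage (B : nat -> set Y) (d : stage) : Prop :=
  if ch d is v :: c then
    [/\ nHs v (pt d), ~ B (nidx v) (f (pt d)), returnable B c (pt d) &
      returnable B (v :: c) (pt d)]
  else False.

Lemma good_stageS (B B' : nat -> set Y) d :
  (forall v, In v (ch d) -> B (nidx v) `<=` B' (nidx v)) ->
  good_stage B' d -> good_stage B d.
Proof.
rewrite /good_stage; case: (ch d) => // v c BB' [h1 h2 h3 h4]; split=> //.
- by move=> /(BB' v (or_introl erefl)).
- by apply: returnableS h3 => w wc; apply: BB'; right.
- by apply: returnableS h4.
Qed.

Lemma finite_bad_values_seq (B : nat -> set Y) (l : seq stage) :
  (forall d, In d l -> good_stage B d) ->
  exists N : seq Y, forall y, y \notin N -> exists V,
    [/\ open V, V y & forall d, In d l -> good_stage (addV B (closure V)) d].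
Proof.
elim: l => [|d l IH] hl.
  by exists [::] => y _; exists setT; split=> //; exact: openT.
have [|N hN] := IH; first by move=> e el; apply: hl; right.
have : good_stage B d by apply: hl; left.
have anti V V' e : V' `<=` V -> good_stage (addV B (closure V)) e ->
    good_stage (addV B (closure V')) e.
  by move=> VV'; apply: good_stageS => v _; apply: setUS; exact: closureS.
rewrite {1}/good_stage; case ed : (ch d) => [//|v c] [h1 h2 h3 h4].
have [N1 hN1] := finite_bad_values h3; have [N2 hN2] := finite_bad_values h4.
(* The value of the stage itself is excluded too, so that the closure of the new set can miss it. *)
exists (f (pt d) :: N ++ N1 ++ N2) => y.
rewrite inE !mem_cat !negb_or => /and4P[/eqP yf /hN[V [oV Vy hV]]
  /hN1[V1 [oV1 V1y hV1]] /hN2[V2 [oV2 V2y hV2]]].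
have [U [oU Uy cU _]] := regular_dist hdY (O := ~` [set f (pt d)]) (x := y)
  (closed_openC (closed_set1 hdY (x := f (pt d)))) yf ltr01.
exists ((U `&` V) `&` (V1 `&` V2)); split.
- by apply: openI; exact: openI.
- by [].
- move=> e /= [<-|el]; last by apply: (anti V) (hV e el) => z [[]].
  rewrite /good_stage ed; split=> //.
  + move=> [//|cf]; have : (~` [set f (pt d)]) (f (pt d)); last by move=> h; apply: h.
    by apply: cU; apply: closureS cf => z [[]].
  + apply: returnableS hV1 => w _; apply: setUS; apply: closureS => z.
    by move=> [_ []].
  + apply: returnableS hV2 => w _; apply: setUS; apply: closureS => z.
    by move=> [_ []].
Qed.

Lemma small_preimage_seq (N : seq Y) : small [set x | f x \in N].
Proof.
elim: N => [|y N IH].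
  by apply: smallS (small0 f) => x.
apply: smallS (smallU (small_fiber hdY hf y) IH) => x /=.
by rewrite inE => /orP[/eqP|]; [left|right].
Qed.

(** By wildness, the points of [H] in [O] off [agree H Hs] are not small, even without those with
    values in [N]. Each remaining point has a basic [V] around its value, small compared with the
    jump of [f] there. One such [V] serves a non-small set, which is cut down to a G_delta set and
    refined by [wild_subset]. *)
Lemma wild_child (H Hs : set X) (S : set X) (O : set X) (V0 : set Y)
    (N : seq Y) (allowed : set Y -> Prop) h :
  wild H Hs -> S `<=` Hs -> open O -> (O `&` H) h -> O `&` H `<=` closure S ->
  open V0 -> (forall x, H x -> V0 (f x)) ->
  (forall y, y \notin N -> exists V, [/\ open V, V y & allowed V]) ->
  (forall V V' : set Y, V' `<=` V -> allowed V -> allowed V') ->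
  exists V H' Hs', [/\ open V, allowed V, V `<=` V0 & wild H' Hs'] /\
    [/\ H' `<=` O `&` H, forall x, H' x -> V (f x) &
      forall x, H' x -> closure (S `&` ~` (f @^-1` closure V)) x].
Proof.
move=> [[gH gHs HsH dH _] cH wH] SHs oO [ Oh Hh] dS oV0 fV0 hN anti.
pose ok m := allowed (BY m) /\ BY m `<=` V0.
pose F m := closure (S `&` ~` (f @^-1` closure (BY m))).
pose A m := if `[< ok m >] then [set x | [/\ (O `&` H) x, BY m (f x) & F m x]]
  else set0.
have [m nA] : exists m, ~ small (A m).
  apply/existsNP => sA; apply: (wH O h oO Oh Hh).
  apply: smallS (smallU (small_preimage_seq N) (small_bigcup sA)) => x [[ Ox Hx] nx].
  case: (boolP (f x \in N)) => [|fN]; [by left|right].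
  have [V1 [oV1 V1x aV1]] := hN _ fN.
  have [e [e0 he]] : exists e, 0 < e /\ forall O', open O' -> O' x ->
      exists u, [/\ O' u, Hs u & e <= dY (f u) (f x)].
    apply: contrapT => hn; apply: nx; split=> // e e0.
    apply: contrapT => hO; apply: hn; exists e; split=> // O' oO' Ox'.
    apply: contrapT => hu; apply: hO; exists O'; split=> // u Ou Gu.
    by rewrite ltNge; apply/negP => le; apply: hu; exists u.
  (* Nearby [u] in [Hs] have values at distance at least e from [f x]; radius e/2 leaves e/2 for
     replacing [u] by a point of [S]. *)
  have [||m [Bm cBm]] := hBY.2 (V1 `&` (V0 `&` [set z | dY (f x) z < e / 2])) (f x).
  - by apply: openI => //; apply: openI => //; exact: open_dball.
  - by split=> //; split; [exact: fV0|rewrite /= (dist_xx hdY); lra].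
  have okm : ok m.
    split; last by move=> z /subset_closure /cBm[_ []].
    by apply: anti aV1 => z /subset_closure /cBm[].
  exists m => //; rewrite /A; case: asboolP => // _; split=> //.
  apply/closureOP => O' oO' O'x.
  have [u [[ Ou O'u] Hu ue]] := he _ (openI oO oO') (conj Ox O'x).
  have [|O1 [oO1 O1u h1]] := cont_on_dist hdY cH Hu (e := e / 2); first by lra.
  have /closureOP/(_ _ (openI oO1 oO') (conj O1u O'u))[w Sw [ O1w O'w]] :=
    dS u (conj Ou (HsH _ Hu)).
  exists w => //; split=> // /cBm[_ [_ /=]].
  have := h1 w O1w (SHs _ Sw); have := dist_tri hdY (f u) (f w) (f x).
  by rewrite (dist_sym hdY (f u) (f w)) (dist_sym hdY (f w) (f x)); lra.
move: nA; rewrite /A; case: asboolP => [[am mV0] nA|_ []]; last exact: small0.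
have [P [gP eP]] := hf (open_Gdelta (hBY.1 m)).
pose G k := (O `&` H) `&` (F m `&` P k).
have PV k x : P k x -> BY m (f x).
  by move=> Px; have : (f @^-1` BY m) x by rewrite eP; exists k.
have [k nG] : exists k, ~ small (G k).
  apply/existsNP => sG; apply: nA; apply: smallS (small_bigcup sG) => x [OHx Bx Fx].
  have : (f @^-1` BY m) x by [].
  by rewrite eP => -[k _ Pk]; exists k.
have gG : Gdelta (G k).
  apply: GdeltaI; first by apply: GdeltaI => //; exact: open_Gdelta.
  by apply: GdeltaI => //; apply: (closed_Gdelta hdX); exact: closed_closure.
have [H' [Hs' [wH' HG]]] := wild_subset hdX cdX hdY hBX hBY hf gG nG.
exists (BY m), H', Hs'; split; first by split=> //; exact: hBY.1.
split.
- by move=> x /HG[].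
- by move=> x /HG[_ [_ /PV]].
- by move=> x /HG[_ []].
Qed.

End Scheme.

(** * The tree of stages *)

Section Construction.
Variables (R : realType) (X Y : topologicalType).
Variables (dX : X -> X -> R) (dY : Y -> Y -> R) (f : X -> Y).
Variables (BX : nat -> set X) (BY : nat -> set Y).
Hypotheses (hdX : compatible_metric dX) (cdX : complete_metric dX).
Hypothesis hdY : compatible_metric dY.
Hypotheses (hBX : regular_base BX) (hBY : regular_base BY).
Hypothesis hf : forall A, Gdelta A -> exists P : nat -> set X,
  (forall i, Gdelta (P i)) /\ f @^-1` A = \bigcup_i P i.

Local Notation small := (small f).
Local Notation wild := (wild dY f).
Local Notation In := List.In.
Local Notation node := (node X Y).
Local Notation stage := (stage X Y).
Local Notation returnable := (returnable f).
Local Notation good_stage := (good_stage f).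

Definition values (l : seq stage) (t : nat) : set Y :=
  nth set0 (map (@sV X Y) l) t.

(** Only sets opened after stage [s] are counted: the set of a node opened at [s], and those of its
    ancestors, contain all values taken on that node. *)
Definition avoided (l : seq stage) (s : nat) : set Y :=
  [set y | exists t, (s < t)%N /\ closure (values l t) y].

Definition node_wf (l : seq stage) (v : node) : Prop :=
  [/\ [/\ forall k, open (nU v k), forall k, open (nUs v k) &
        wild (nH v) (nHs v)],
    open (nV v), forall x, nH v x -> nV v (f x), (nidx v < size l)%N &
    values l (nidx v) = nV v].

Fixpoint chain_wf (l : seq stage) (c : seq node) : Prop :=
  if c is v :: c' then
    [/\ node_wf l v, forall w, In w c' -> (nidx w < nidx v)%N /\ nH v `<=` nH w
      & chain_wf l c']
  else True.

Definition stages_wf (l : seq stage) : Prop := forall d, In d l ->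
  [/\ open (nb d), nb d (pt d), chain_wf l (ch d),
    forall v, In v (ch d) -> nH v (pt d) & good_stage (avoided l) d].

(** The root has no parent; a return from it stays there. *)
Definition pop (c : seq node) : seq node :=
  if c is _ :: (_ :: _) as c' then c' else c.

(** A limit point thus falls into [nH v] if [v] stays in the chain from some time on, and into
    [nHs v] if [v] is at its head infinitely often. *)
Definition nb_small (n : nat) (d : stage) : Prop :=
  [/\ forall y z, nb d y -> nb d z -> dX y z < n.+1%:R^-1,
    forall v, In v (ch d) -> forall k, (k <= n)%N -> nb d `<=` nU v k &
    forall v c, ch d = v :: c -> forall k, (k <= n)%N -> nb d `<=` nUs v k].

(* Stages form a binary tree in heap order: the stage [2p+1] opens a new node
   below the node of the stage [p], and [2p+2] returns to the parent node. *)
Definition next_stage (l : seq stage) (d : stage) : Prop :=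
  [/\ nb_small (size l) d, l = [::] -> exists v, ch d = [:: v] &
    l <> [::] -> let q := nth d l (size l).-1./2 in
      closure (nb d) `<=` nb q /\
      if odd (size l) then exists v, ch d = v :: ch q else ch d = pop (ch q)].

Lemma In_rcons (T : Type) (x y : T) s : In x (rcons s y) <-> In x s \/ x = y.
Proof.
elim: s => [|z s IH] /=; first by split=> [[->|//]|[//|->]]; [right|left].
by rewrite IH; tauto.
Qed.

Lemma In_nth (T : Type) (x : T) s i : (i < size s)%N -> In (nth x s i) s.
Proof. by elim: s i => // y s IH [|i] /= h; [left|right; exact: IH]. Qed.

Lemma values_rcons l d t : values (rcons l d) t =
  if (t < size l)%N then values l t else if t == size l then sV d else set0.
Proof. by rewrite /values map_rcons nth_rcons size_map. Qed.

Lemma values_default l t : (size l <= t)%N -> values l t = set0.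
Proof. by move=> h; rewrite /values nth_default // size_map. Qed.

Lemma avoided_rcons l d s y : avoided (rcons l d) s y <->
  avoided l s y \/ (s < size l)%N /\ closure (sV d) y.
Proof.
split=> [[t [st]]|[[t [st ct]]|[sl cy]]].
- rewrite values_rcons; case: ltnP => [tl ct|tl]; first by left; exists t.
  case: eqP => [tE cy|_]; first by right; rewrite -tE.
  by rewrite closure0.
- exists t; split=> //; rewrite values_rcons; case: ltnP => // tl.
  by move: ct; rewrite values_default // closure0.
- by exists (size l); split=> //; rewrite values_rcons ltnn eqxx.
Qed.

Lemma avoided_ge l s y : (size l <= s.+1)%N -> ~ avoided l s y.
Proof.
move=> h [t [st]]; rewrite values_default ?closure0 //.
exact: leq_trans h st.
Qed.

Lemma chain_wf_rcons l d c : chain_wf l c -> chain_wf (rcons l d) c.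
Proof.
elim: c => //= v c IH [[w oV fV il eV] hv /IH hc]; split=> //; split=> //.
  by rewrite size_rcons ltnS ltnW.
by rewrite values_rcons il.
Qed.

Lemma chain_wf_In l c v : chain_wf l c -> In v c -> node_wf l v.
Proof. by elim: c => //= w c IH [hw _ /IH hc] [<-|]. Qed.

Lemma open_finite_inter (U : nat -> set X) n : (forall k, open (U k)) ->
  exists O, [/\ open O, \bigcap_k U k `<=` O & forall k, (k <= n)%N -> O `<=` U k].
Proof.
move=> oU; elim: n => [|n [ O [oO UO OU]]].
  by exists (U 0%N); split=> // [x|k]; [exact|rewrite leqn0 => /eqP->].
exists (O `&` U n.+1); split; first exact: openI.
  by move=> x Ux; split; [exact: UO|exact: Ux].
move=> k; rewrite leq_eqVlt => /orP[/eqP -> y []//|kn] y [ Oy _].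
by apply: (OU k).
Qed.

Lemma exists_nb l n (v : node) c x O : chain_wf l (v :: c) ->
  (forall w, In w (v :: c) -> nH w x) -> nHs v x -> open O -> O x ->
  exists O', [/\ open O', O' x, closure O' `<=` O &
    forall V, nb_small n (Stage x O' V (v :: c))].
Proof.
move=> wf Hx Hsx oO Ox.
have [ O1 [oO1 O1x h1]] : exists O1, [/\ open O1, O1 x &
    forall w, In w (v :: c) -> forall k, (k <= n)%N -> O1 `<=` nU w k].
  elim: (v :: c) wf Hx => [|w s IH]; first by exists setT; split=> //; exact: openT.
  move=> [[[oU _ _] _ _ _ _] _ wf] Hx.
  have [|O1 [oO1 O1x h1]] := IH wf; first by move=> u us; apply: Hx; right.
  have [ O2 [oO2 HO2 h2]] := open_finite_inter n oU.
  exists (O1 `&` O2); split; first exact: openI.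
    by split=> //; apply/HO2/Hx; left.
  move=> u [<-|us] k kn y [ O1y O2y]; first exact: (h2 k).
  exact: (h1 u).
have [[[_ oUs _] _ _ _ _] _ _] := wf.
have [ O2 [oO2 HO2 h2]] := open_finite_inter n oUs.
have [|||O' [oO' O'x cO' sO']] := regular_dist hdX (O := O `&` (O1 `&` O2)) (x := x)
    _ _ (e := n.+1%:R^-1).
- by apply: openI => //; apply: openI.
- by split=> //; split=> //; exact: HO2.
- by rewrite invr_gt0.
exists O'; split=> //; first by move=> y /cO'[].
move=> V; split=> //=.
- by move=> w wc k kn y /subset_closure /cO'[_ [/h1 h _]]; exact: h.
- by move=> w c' [<- _] k kn y /subset_closure /cO'[_ [_ /h2]]; exact.
Qed.

(** Nothing is forbidden yet at a new node, so the density of [nHs v] in [nH v] suffices. *)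
Lemma returnable_fresh (B : nat -> set Y) (v : node) c x :
  nH v `<=` closure (nHs v) -> nHs v `<=` nH v ->
  (forall y, ~ B (nidx v) y) -> (forall y, nHs v y -> returnable B c y) ->
  nHs v x -> returnable B (v :: c) x.
Proof.
move=> dH HsH nB rc Hx O oO Ox; exists O; split=> //.
  by exists x; split=> //; exact: HsH.
move=> y [ Oy /dH]; apply: closureS => z Hz; split; [split=> //; exact: nB|].
exact: rc.
Qed.

Lemma Gdelta_node (l : seq stage) i (H Hs : set X) (V : set Y) :
  wild H Hs -> open V -> (forall x, H x -> V (f x)) ->
  (i < size l)%N -> values l i = V ->
  exists v : node, [/\ node_wf l v, nidx v = i, nH v = H, nHs v = Hs & nV v = V].
Proof.
move=> wH oV fV il eV; have [[[U oU eU] [Us oUs eUs] _ _ _] _ _] := wH.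
exists (Node i U Us V); split=> //; rewrite /node_wf /nH /nHs /= -?eU -?eUs //.
Qed.

Lemma first_stage : ~ small setT -> exists d, stages_wf [:: d] /\ next_stage [::] d.
Proof.
move=> nX; have [H [Hs [wH _]]] := wild_subset hdX cdX hdY hBX hBY hf (@GdeltaT X) nX.
have [[_ _ HsH dH [x Hx]] _ _] := wH.
have hv d0 : sV d0 = setT -> exists v : node,
    [/\ node_wf [:: d0] v, nidx v = 0%N, nH v = H, nHs v = Hs & nV v = setT].
  by move=> e; apply: Gdelta_node => //; exact: openT.
(* [node_wf] sees the list only through its length and the sets [sV], so a dummy stage can stand in
   for the one being built. *)
have [v [wv iv eH eHs eV]] := hv (Stage x setT setT [::]) erefl.
have wv' d0 : sV d0 = setT -> node_wf [:: d0] v.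
  by move: wv => [a b c e _] h; split=> //; rewrite iv /values /= h eV.
have [|||||O [oO Ox _ hO]] := @exists_nb [:: Stage x setT setT [::]] 0 v [::] x setT.
- by split=> //; exact: wv'.
- by move=> w [<-|//]; rewrite eH; exact: HsH.
- by rewrite eHs.
- exact: openT.
- by [].
exists (Stage x O setT [:: v]); split; last by split=> // _; exists v.
move=> d /= [<-|//]; split=> //=.
- by move=> w [<-|//]; rewrite eH; exact: HsH.
- have nB y : ~ avoided [:: Stage x O setT [:: v]] (nidx v) y.
    by apply: avoided_ge; rewrite iv.
  by split; rewrite ?eHs //; apply: returnable_fresh; rewrite ?eH ?eHs.
Qed.

Lemma new_node_stage (l : seq stage) (q : stage) : stages_wf l -> In q l ->
  exists d v, [/\ stages_wf (rcons l d), nb_small (size l) d,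
    closure (nb d) `<=` nb q & ch d = v :: ch q].
Proof.
move=> wl ql; have [onb nbq wfq Hq gq] := wl q ql.
move: gq; rewrite /good_stage; case ec : (ch q) => [//|v c].
move=> [Hsv nB rc rvc]; rewrite ec in wfq Hq.
have [[[oU oUs wv] oV fV vl eV] hvc wfc] := wfq.
have [[_ _ HsHv dHv _] cHv _] := wv.
have [ O [oO Onb [h Oh] dS]] := rvc _ onb nbq.
have [N hN] := finite_bad_values_seq hdY (B := avoided l) (l := l)
  (fun d dl => let: And5 _ _ _ _ g := wl d dl in g).
have [||V [H' [Hs' [[oV' aV' V'V wH'] [H'O fV' cH']]]]] :=
  wild_child hdX cdX hdY hBX hBY hf wv _ oO Oh dS oV fV hN _.
- by move=> y [[]].
- by move=> W W' WW' aW d /aW; apply: good_stageS => u _; apply: setUS; exact: closureS.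
pose l0 O' s := rcons l (Stage h O' V s).
have [v' [wv' iv' eH eHs eV']] :
    exists v' : node, [/\ node_wf (l0 setT [::]) v', nidx v' = size l, nH v' = H',
      nHs v' = Hs' & nV v' = V].
  apply: Gdelta_node => //; first by rewrite size_rcons.
  by rewrite values_rcons ltnn eqxx.
have [[_ _ HsH' dH' [x Hx]] _ _] := wH'.
have H'v : H' `<=` nH v by move=> y /H'O[].
have vH u : In u (v :: c) -> nH v `<=` nH u.
  by move=> [<-//|/hvc[]].
have wfd d : sV d = V -> chain_wf (rcons l d) [:: v', v & c].
  move=> ed; split; last exact: (@chain_wf_rcons l d (v :: c)).
    have [a b e _ _] := wv'; split=> //; rewrite iv' ?size_rcons //.
    by rewrite values_rcons ltnn eqxx ed eV'.
  move=> u uc; split; last by rewrite eH; exact: subset_trans (vH u uc).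
  by rewrite iv'; have [] := chain_wf_In wfq uc.
have Hx' u : In u [:: v', v & c] -> nH u x.
  move=> [<-|/vH]; first by rewrite eH; exact: HsH'.
  by apply; exact/H'v/HsH'.
have [||O' [oO' O'x cO' sO']] := exists_nb (size l) (wfd (Stage x setT V [::]) erefl)
  Hx' _ onb _ .
- by rewrite eHs.
- by apply: Onb; case: (H'O _ (HsH' _ Hx)).
exists (Stage x O' V [:: v', v & c]), v'; split=> //.
set d := Stage _ _ _ _.
(* Near [y] there are points of [S] with values off the closure of [V]. By continuity on [nHs v]
   this persists on an open set, where [S] is still dense. *)
have rH y : H' y -> returnable (avoided (rcons l d)) (v :: c) y.
  move=> Hy O1 oO1 O1y.
  have /closureOP/(_ _ (openI oO oO1))[] := cH' y Hy.
    by split=> //; case: (H'O y Hy).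
  move=> u [Su nu] [ Ou O1u]; have [[Hu _] _] := Su.
  have [ O2 [oO2 O2u h2]] := cHv u Hu _ (@open_setCclosure _ V) nu.
  exists (O2 `&` (O `&` O1)); split.
  - by apply: openI => //; exact: openI.
  - by move=> z [_ []].
  - by exists u; split=> //; exact: HsHv.
  - move=> z [[ O2z [ Oz O1z]] Hz]; apply/closureOP => O3 oO3 O3z.
    have /closureOP/(_ _ (openI oO2 oO3) (conj O2z O3z))[s [[Hs nBs] rs] [ O2s O3s]] :=
      dS z (conj Oz Hz).
    exists s => //; split; first split=> //.
      by move=> /avoided_rcons[//|[_]]; exact: h2.
    (* The ancestors [w] of [v] were opened earlier and already avoid the closure of [nV v], which
       contains that of [V]. *)
    apply: returnableS rs => w wc y' /avoided_rcons[//|[_ /= cy]].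
    exists (nidx v); split; first by case: (hvc w wc).
    by rewrite eV; move: cy; apply: closureS.
move=> e /In_rcons[el|->]; last first.
  split=> //; first exact: wfd.
  have nBv' y : ~ avoided (rcons l d) (nidx v') y.
    by apply: avoided_ge; rewrite iv' size_rcons.
  split; rewrite ?eHs //; first by apply: rH; exact: HsH'.
  apply: returnable_fresh; rewrite ?eH ?eHs // => y Hy.
  by apply: rH; exact: HsH'.
have [a b c' e' _] := wl e el; split=> //; first exact: chain_wf_rcons.
apply: good_stageS (aV' e el) => u _ y /avoided_rcons[|[_]]; first by left.
by right.
Qed.

Lemma good_stage_set0 l d : sV d = set0 -> forall e,
  good_stage (avoided l) e -> good_stage (avoided (rcons l d)) e.
Proof.
move=> ed e; apply: good_stageS => v _ y /avoided_rcons[//|[_]].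
by rewrite ed closure0.
Qed.

(** A return opens no set: [sV] is empty, and the other stages acquire nothing new to avoid. *)
Lemma return_stage (l : seq stage) (q : stage) : stages_wf l -> In q l ->
  exists d, [/\ stages_wf (rcons l d), nb_small (size l) d,
    closure (nb d) `<=` nb q & ch d = pop (ch q)].
Proof.
move=> wl ql; have [onb nbq wfq Hq gq] := wl q ql.
suff [x [v [c [ec gx nbx hHx]]]] : exists x v c, [/\ pop (ch q) = v :: c,
    forall O, good_stage (avoided l) (Stage x O set0 (v :: c)), nb q x &
    forall u, In u (v :: c) -> nH u x].
  have wfvc : chain_wf l (v :: c).
    move: wfq ec; case: (ch q) => [//|w [|w' s]] /=; first by move=> ? [<- <-].
    by move=> [_ _ ?] [<- <-].
  have [|O [oO Ox cO sO]] := exists_nb (size l) wfvc hHx _ onb nbx.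
    by case: (gx setT).
  exists (Stage x O set0 (v :: c)); split=> //.
  move=> e /In_rcons[/wl[a b c' e' g]|->].
    by split=> //; [exact: chain_wf_rcons|exact: good_stage_set0].
  split=> //; [exact: chain_wf_rcons|apply: good_stage_set0 => //].
move: gq; rewrite /good_stage; case ec : (ch q) => [//|v [|v' c]] /=.
  by move=> g; exists (pt q), v, [::]; split=> // u uc; apply: Hq; rewrite ec.
rewrite ec in wfq Hq => -[_ _ rq _].
have [_ _ [[[_ _ wv'] _ _ _ _] hv' _]] := wfq.
have [[_ _ HsH _ _] _ _] := wv'.
have [ O [oO Onb [h Oh] dS]] := rq _ onb nbq.
have /closureOP/(_ O oO)[|u [[Hu nBu] ru] Ou] := dS h Oh; first by case: Oh.
exists u, v', c; split=> //.
(* The density obtained from [q] holds throughout [O], hence near [u] as well. *)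
- move=> _; split=> // O1 oO1 O1u; exists (O1 `&` O); split.
  + exact: openI.
  + by move=> y [].
  + by exists u; split=> //; exact: HsH.
  + move=> z [[ O1z Oz] Hz]; have /closureOP h' := dS z (conj Oz Hz).
    by apply/closureOP.
- exact: Onb.
- by move=> w [<-|/hv'[_]]; [exact: HsH|apply; exact: HsH].
Qed.

Lemma exists_next_stage (l : seq stage) : ~ small setT -> stages_wf l ->
  exists d, stages_wf (rcons l d) /\ next_stage l d.
Proof.
move=> nX wl; have [->|lN] : l = [::] \/ l <> [::] by case: l {wl}; [left|right].
  exact: first_stage.
have sl : ((size l).-1./2 < size l)%N by case: l lN {wl} => //= a s _; lia.
have [q0 _] : exists q0, In q0 l by case: l lN {wl sl} => // a s _; exists a; left.
have ql := In_nth q0 sl; case: (boolP (odd (size l))) => ol.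
  have [d [v [wd sd cd ed]]] := new_node_stage wl ql.
  exists d; split=> //; split=> // _ /=; rewrite (set_nth_default q0) //.
  by rewrite ol; split=> //; exists v.
have [d [wd sd cd ed]] := return_stage wl ql.
exists d; split=> //; split=> // _ /=; rewrite (set_nth_default q0) //.
by rewrite (negbTE ol).
Qed.

Lemma stage_sequence : ~ small setT -> exists b : nat -> stage,
  forall n, stages_wf (mkseq b n) /\ next_stage (mkseq b n) (b n).
Proof.
move=> nX.
have [d0 _] := first_stage nX.
have [||l hl] := @dependent_choice_stages (seq stage)
  (fun n l => size l = n /\ stages_wf l)
  (fun n l l' => exists2 d, l' = rcons l d & next_stage l d).
- by exists [::].
- move=> n l [sl wl]; have [d [wd nd]] := exists_next_stage nX wl.
  by exists (rcons l d); split; [rewrite size_rcons sl|exists d].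
pose b n := nth d0 (l n.+1) n.
have eb n : l n = mkseq b n.
  elim: n => [|n IH]; first by case: (hl 0%N) => -[/size0nil].
  have [[sn _] [d ed _]] := hl n.
  by rewrite mkseqS -IH ed /b ed nth_rcons sn ltnn eqxx.
exists b => n; have [[sn wn] [d ed nd]] := hl n; rewrite -eb; split=> //.
by rewrite /b ed nth_rcons sn ltnn eqxx.
Qed.

End Construction.

(** * Branches of unbounded depth *)

Section Cantor.
Local Open Scope nat_scope.
Implicit Types (z : nat -> bool) (n m : nat).

(** The length of the chain after [n] steps of the branch [z]: [true] opens a node, [false] returns,
    and the bound 1 mirrors [pop] at the root. *)
Fixpoint depth z n : nat := if n is n'.+1 then
  if z n' then (depth z n').+1 else maxn 1 (depth z n').-1 else 1%N.

Definition same_prefix z z' n := forall i, (i < n)%N -> z' i = z i.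

Definition escapes z := forall m, exists N, forall n, (N <= n)%N -> (m <= depth z n)%N.

Lemma depth_gt0 z n : (0 < depth z n)%N.
Proof. by case: n => //= n; case: (z n) => //; lia. Qed.

Lemma depth_prefix z z' n : same_prefix z z' n -> forall m, (m <= n)%N ->
  depth z' m = depth z m.
Proof.
move=> h; elim=> //= m IH mn; rewrite h // IH //; exact: ltnW.
Qed.

Lemma same_prefixW z z' n m : (m <= n)%N -> same_prefix z z' n -> same_prefix z z' m.
Proof. by move=> mn h i im; apply: h; exact: leq_trans mn. Qed.

Lemma same_prefix_trans z1 z2 z3 n : same_prefix z1 z2 n -> same_prefix z2 z3 n ->
  same_prefix z1 z3 n.
Proof. by move=> h1 h2 i il; rewrite h2 ?h1. Qed.

Lemma prefix_limit (p : nat -> (nat -> bool) * nat) :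
  (forall k, ((p k).2 < (p k.+1).2)%N /\ same_prefix (p k).1 (p k.+1).1 (p k).2) ->
  exists z, forall k, same_prefix (p k).1 z (p k).2.
Proof.
move=> hp.
have mono k j : ((p k).2 <= (p (k + j)).2)%N /\ same_prefix (p k).1 (p (k + j)).1 (p k).2.
  elim: j => [|j [IH1 IH2]]; first by rewrite addn0; split=> [|i].
  have [h1 h2] := hp (k + j)%N; rewrite addnS; split; first exact: leq_trans (ltnW h1).
  exact: same_prefix_trans IH2 (same_prefixW IH1 h2).
have ge k : (k <= (p k).2)%N.
  by elim: k => // k IH; case: (hp k) => h _; exact: leq_ltn_trans h.
exists (fun i => (p i.+1).1 i) => k i ik.
case: (leqP k i.+1) => ki.
  by have [_] := mono k (i.+1 - k)%N; rewrite subnKC //; exact.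
have [_ h] := mono i.+1 (k - i.+1)%N; rewrite subnKC ?(ltnW ki) // in h.
by rewrite h //; exact: ge.
Qed.

(** A pair [z], [n] stands for the word of the first [n] letters of [z]. Here and in [stays] the
    word is extended without dropping below its depth, by a full escaping branch and by a finite
    word respectively. *)
Definition above z n : set (nat -> bool) := [set z' |
  [/\ same_prefix z z' n, forall m, (n <= m)%N -> (depth z n <= depth z' m)%N &
    escapes z']].

Definition stays z n z' n' := [/\ (n <= n')%N, same_prefix z z' n &
  forall m, (n <= m <= n')%N -> (depth z n <= depth z' m)%N].

Definition prefix_open (W : set (nat -> bool)) :=
  forall z, W z -> exists n, forall z', same_prefix z z' n -> W z'.

(** A Baire argument for escaping branches: otherwise the word can be extended step by step to avoid
    each [B k], with a rising floor for the depth, and the limit escapes. *)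
Lemma escapes_locally_dense (B : nat -> set (nat -> bool)) :
  (forall z, escapes z -> exists k, B k z) ->
  exists k z n, forall z' n', stays z n z' n' -> exists2 z'', above z' n' z'' & B k z''.
Proof.
move=> hB; apply: contrapT => hn.
have {}hn k z n : exists z' n', stays z n z' n' /\
    forall z'', above z' n' z'' -> ~ B k z''.
  apply: contrapT => h; apply: hn; exists k, z, n => z' n' hs.
  apply: contrapT => h'; apply: h; exists z', n'; split=> // z'' az Bz.
  by apply: h'; exists z''.
have [||p hp] := @dependent_choice_stages ((nat -> bool) * nat) (fun _ _ => True)
  (fun k p q => [/\ (p.2 < q.2)%N, same_prefix p.1 q.1 p.2,
     forall m, (p.2 <= m <= q.2)%N -> (depth p.1 p.2 <= depth q.1 m)%N,
     (depth p.1 p.2 < depth q.1 q.2)%N &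
     forall z, above q.1 q.2 z -> ~ B k z]).
- by exists (fun=> true, 0%N).
- move=> k [z n] _; have [z' [n' [[nn' zz' dz'] hB']]] := hn k z n.
  (* The additional [true] raises the floor by one. *)
  pose w i := if (i < n')%N then z' i else true.
  have z'w : same_prefix z' w n' by move=> i il; rewrite /w il.
  have dw := depth_prefix z'w.
  have dwn : depth w n'.+1 = (depth z' n').+1 by rewrite /= /w ltnn -/w dw.
  exists (w, n'.+1); split=> //; split=> /=; rewrite -/(depth w n'.+1) ?dwn.
  + by rewrite ltnS.
  + exact: same_prefix_trans zz' (same_prefixW nn' z'w).
  + move=> m /andP[nm]; rewrite leq_eqVlt => /orP[/eqP->|]; last first.
      by rewrite ltnS => mn'; rewrite dw //; apply: dz'; rewrite nm.
    by rewrite dwn ltnW // ltnS; apply: dz'; rewrite nn' /=.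
  + by rewrite ltnS; apply: dz'; rewrite nn' /=.
  + move=> y [wy dy ey]; apply: hB'; split=> //.
      exact: same_prefix_trans z'w (same_prefixW (leqnSn _) wy).
    move=> m; rewrite leq_eqVlt => /orP[/eqP<-|mn].
      by rewrite (depth_prefix wy) // dw.
    by apply: leq_trans (dy m mn); rewrite dwn.
have {}hp k := (hp k).2.
have [z hz] := prefix_limit (fun k => let: And5 a b _ _ _ := hp k in conj a b).
have dk k : (k <= depth (p k).1 (p k).2)%N.
  by elim: k => // k IH; case: (hp k) => _ _ _ h _; exact: leq_ltn_trans h.
have ge j : (j <= (p j).2)%N.
  by elim: j => // j IH; case: (hp j) => h _ _ _ _; exact: leq_ltn_trans h.
have dz m : forall i k, (m - (p k).2 <= i)%N -> ((p k).2 <= m)%N ->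
    (depth (p k).1 (p k).2 <= depth z m)%N.
  elim=> [|i IH] k; have [h1 _ h3 h4 _] := hp k => mi km.
    have -> : m = (p k).2 by lia.
    by rewrite (depth_prefix (hz k)).
  case: (leqP m (p k.+1).2) => mk.
    by rewrite (depth_prefix (hz k.+1)) //; apply: h3; rewrite km.
  by apply: leq_trans (ltnW h4) _; apply: IH; lia.
have ez : escapes z.
  move=> m; exists (p m).2 => n mn.
  by apply: leq_trans (dk m) _; exact: (dz n (n - (p m).2)%N).
have [k Bk] := hB z ez; case: (hp k) => _ _ _ _ /(_ z) h; apply: h Bk.
by split=> // m; exact: (dz m (m - (p k.+1).2)%N).
Qed.

(* A prefix of a path that returns to the level [depth z n] infinitely often
   can be kept inside all the open sets [W j]. *)
Lemma nonescaping_in_Gdelta (W : nat -> set (nat -> bool)) z n :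
  (forall j, prefix_open (W j)) ->
  (forall z' n', stays z n z' n' ->
    exists2 z'', above z' n' z'' & forall j, W j z'') ->
  exists z', ~ escapes z' /\ forall j, W j z'.
Proof.
move=> oW hW.
have [||p hp] := @dependent_choice_stages ((nat -> bool) * nat)
  (fun _ p => stays z n p.1 p.2 /\ depth p.1 p.2 = depth z n)
  (fun j p q => [/\ (p.2 < q.2)%N, same_prefix p.1 q.1 p.2 &
     forall z', same_prefix q.1 z' q.2 -> W j z']).
- exists (z, n); split=> //; split=> //= m /andP[nm mn].
  by have -> : m = n by apply/eqP; rewrite eqn_leq mn.
- move=> j [z1 n1] /= [s1 d1]; have [y [z1y dy _] Wy] := hW z1 n1 s1.
  have [N hN] := oW j y (Wy j).
  have [nn1 zz1 dz1] := s1.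
  pose N' := maxn N n1.+1.
  (* Once a prefix of [y] has secured [W j], letters [false] bring the depth back to exactly
     [depth z n]. *)
  pose w i := if (i < N')%N then y i else false.
  have yw : same_prefix y w N' by move=> i il; rewrite /w il.
  have dN' : (depth z n <= depth y N')%N by rewrite -d1; apply: dy; rewrite /N'; lia.
  have dw t : (t <= depth y N' - depth z n)%N ->
      depth w (N' + t) = (depth y N' - t)%N.
    elim: t => [|t IH] tl; first by rewrite addn0 subn0 (depth_prefix yw).
    rewrite addnS /= IH; last exact: ltnW.
    rewrite /w ltnNge leq_addr /=; have := depth_gt0 z n; lia.
  have Nn1 : (n1 < N')%N by rewrite /N'; lia.
  have z1w : same_prefix z1 w n1.
    exact: same_prefix_trans z1y (same_prefixW (ltnW Nn1) yw).
  exists (w, (N' + (depth y N' - depth z n))%N) => /=; split; last first.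
    split=> //; first by apply: leq_trans Nn1 (leq_addr _ _).
    move=> z' /(same_prefixW (leq_addr _ _)) h; apply: hN.
    apply: same_prefix_trans (same_prefixW _ yw) (same_prefixW _ h);
      by rewrite /N' leq_maxl.
  split; last by rewrite dw //; lia.
  split=> /=; first lia.
    exact: same_prefix_trans zz1 (same_prefixW nn1 z1w).
  move=> m /andP[nm mN]; case: (leqP m n1) => mn1.
    by rewrite (depth_prefix z1w) //; apply: dz1; rewrite nm.
  case: (leqP m N') => mN'.
    by rewrite (depth_prefix yw) // -d1; apply: dy; exact: ltnW.
  have -> : m = (N' + (m - N'))%N by lia.
  by rewrite dw; lia.
have [z' hz'] := prefix_limit (fun j => let: And3 a b _ := (hp j).2 in conj a b).
have ge j : (j <= (p j).2)%N.
  by elim: j => // j IH; case: (hp j) => _ [h _ _]; exact: leq_ltn_trans h.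
exists z'; split; last by move=> j; case: (hp j) => _ [_ _]; apply; exact: hz'.
move=> /(_ (depth z n).+1) [N /(_ (p N).2 (ge N))].
by rewrite (depth_prefix (hz' N)) //; case: (hp N) => -[_ ->]; rewrite ltnn.
Qed.

Lemma escapes_not_Sigma3 (W : nat -> nat -> set (nat -> bool)) :
  (forall k j, prefix_open (W k j)) ->
  ~ (forall z, escapes z <-> exists k, forall j, W k j z).
Proof.
move=> oW hW.
have [|k [z [n h]]] := @escapes_locally_dense (fun k => [set z | forall j, W k j z]).
  by move=> z /hW.
have [z' [nz' hz']] := nonescaping_in_Gdelta (oW k) h.
by apply/nz'/hW; exists k.
Qed.

End Cantor.

(** * Limits along branches *)

Section Paths.
Variables (R : realType) (X Y : topologicalType).
Variables (dX : X -> X -> R) (dY : Y -> Y -> R) (f : X -> Y).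
Variable b : nat -> stage X Y.
Hypotheses (hdX : compatible_metric dX) (cdX : complete_metric dX).
Hypothesis hb : forall n,
  stages_wf dY f (mkseq b n) /\ next_stage dX (mkseq b n) (b n).
Implicit Types (z : nat -> bool) (n m : nat).

Fixpoint heap_index z n : nat :=
  if n is n'.+1 then
    if z n' then (heap_index z n').*2.+1 else (heap_index z n').*2.+2
  else 0%N.

Local Notation path_stage z n := (b (heap_index z n)).

Lemma heap_index_ge z n : (n <= heap_index z n)%N.
Proof. by elim: n => //= n IH; case: (z n); lia. Qed.

Lemma heap_index_prefix z z' n :
  same_prefix z z' n -> heap_index z' n = heap_index z n.
Proof.
elim: n => //= n IH h; rewrite h // IH //.
exact: same_prefixW h.
Qed.

Lemma stage_wf i n : (i < n)%N ->
  [/\ open (nb (b i)), nb (b i) (pt (b i)), chain_wf dY f (mkseq b n) (ch (b i)),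
    forall v, List.In v (ch (b i)) -> nH v (pt (b i)) &
    good_stage f (avoided (mkseq b n)) (b i)].
Proof.
move=> il; apply: (hb n).1; rewrite -(nth_mkseq (b 0%N) b il).
by apply: In_nth; rewrite size_mkseq.
Qed.

Lemma values_mkseq n t : (t < n)%N -> values (mkseq b n) t = sV (b t).
Proof.
by move=> tl; rewrite /values (nth_map (b 0%N)) ?size_mkseq // nth_mkseq.
Qed.

Lemma path_step z n :
  closure (nb (path_stage z n.+1)) `<=` nb (path_stage z n) /\
  if z n then exists v, ch (path_stage z n.+1) = v :: ch (path_stage z n)
  else ch (path_stage z n.+1) = pop (ch (path_stage z n)).
Proof.
set j := heap_index z n.+1; set i := heap_index z n.
have [_ [_ _]] := hb j; rewrite size_mkseq.
have j0 : (0 < j)%N by rewrite /j /=; case: (z n).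
have -> : j.-1./2 = i by rewrite /j /= -/i; case: (z n); lia.
have ij : (i < j)%N by rewrite /j /= -/i; case: (z n); lia.
rewrite nth_mkseq // => h; have [|hc ho] := h.
  by move=> /(congr1 size); rewrite size_mkseq /=; lia.
split=> //; move: ho; rewrite /j /= -/i.
by case: (z n) => /=; rewrite odd_double.
Qed.

Lemma size_pop (c : seq (node X Y)) :
  size (pop c) = if (size c <= 1)%N then size c else (size c).-1.
Proof. by case: c => [|v [|w c]]. Qed.

Lemma size_chain z n : size (ch (path_stage z n)) = depth z n.
Proof.
elim: n => [|n IH].
  have [_ [_ /(_ erefl)[v /= -> _]]] := hb 0%N.
  by [].
have [_] := path_step z n; rewrite /=; case: (z n) => [[v ->]|->] /=.
  by rewrite IH.
by rewrite size_pop IH; have := depth_gt0 z n; case: ifP; lia.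
Qed.

Lemma path_limit z : exists x, forall n, nb (path_stage z n) x.
Proof.
apply: (nested_open_point (d := dX)) => //.
- move=> n; exists (pt (path_stage z n)).
  by case: (stage_wf (ltnSn (heap_index z n))).
- by move=> n; case: (path_step z n).
- move=> e e0; have [n ne] := small_inv e0; exists n => x y hx hy.
  have [_ [[h _ _] _ _]] := hb (heap_index z n); rewrite size_mkseq in h.
  apply: lt_trans (h x y hx hy) (le_lt_trans _ ne).
  by rewrite lef_pV2 ?posrE // ler_nat ltnS heap_index_ge.
Qed.

Lemma chain_wf_size l (v : node X Y) c : chain_wf dY f l (v :: c) -> (size c <= nidx v)%N.
Proof.
elim: c v => //= w c IH v [_ h wc]; have [wv _] := h w (or_introl erefl).
exact: leq_ltn_trans (IH w wc) wv.
Qed.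

(** Only the head of a chain is ever removed, so the last m+1 nodes survive while the depth exceeds
    [m]. *)
Lemma stable_suffix z m N : (forall n, (N <= n)%N -> (m < depth z n)%N) ->
  exists v c, size c = m /\
  forall n, (N <= n)%N -> exists s, ch (path_stage z n) = s ++ v :: c.
Proof.
move=> hN.
have sN : (m < size (ch (path_stage z N)))%N by rewrite size_chain hN.
pose k := (size (ch (path_stage z N)) - m.+1)%N.
have [v [c [ec sc]]] : exists v c, drop k (ch (path_stage z N)) = v :: c /\ size c = m.
  have : size (drop k (ch (path_stage z N))) = m.+1 by rewrite size_drop /k; lia.
  by case: (drop _ _) => // v c [sc]; exists v, c.
exists v, c; split=> // n /subnKC <-; elim: (n - N)%N => [|i [s es]].
  by rewrite addn0; exists (take k (ch (path_stage z N))); rewrite -ec cat_take_drop.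
have [_] := path_step z (N + i)%N; rewrite -addnS.
have := size_chain z (N + i.+1)%N; have := hN (N + i.+1)%N (leq_addr _ _).
case: (z _) => [_ _ [w ->]|ld sd e]; first by exists (w :: s); rewrite es.
move: sd ld; rewrite e es; case: s {e es} => [|w s] /=.
  case: c sc {ec} => [|w c] /=; first by move=> _ _ _; exists [::].
  by move=> <- <-; rewrite ltnn.
move=> _ _; case: s => [|w' s] /=; first by exists [::].
by exists (w' :: s).
Qed.

(** At each height some node [v] becomes permanent; then [x] is in [nH v] and [f x] in the open set
    [nV v]. Stage numbers increase strictly along a chain, so [nidx v] is at least [m]. *)
Lemma escaping_value z x : escapes z -> (forall n, nb (path_stage z n) x) ->
  forall m, exists2 t, (m <= t)%N & interior (sV (b t)) (f x).
Proof.
move=> ez hx m; have [N hN] := ez m.+1.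
have [v [c [sc hc]]] := stable_suffix hN.
have hv n : (N <= n)%N -> List.In v (ch (path_stage z n)).
  by move=> /hc[s ->]; elim: s => [|w s IH]; [left|right].
have wf := stage_wf (ltnSn (heap_index z N)).
have [_ oV fV il eV] : node_wf dY f (mkseq b (heap_index z N).+1) v.
  by case: wf => _ _ wf _ _; apply: chain_wf_In wf (hv N (leqnn N)).
rewrite size_mkseq in il; rewrite values_mkseq // in eV.
exists (nidx v).
  have [s es] := hc N (leqnn N); rewrite -sc.
  case: wf => _ _ wf _ _; move: wf; rewrite es.
  by elim: s {es} => [|w s IH] /=; [exact: chain_wf_size|case=> _ _ /IH].
rewrite eV; suff Vx : nV v (f x) by exact: open_nbhs_nbhs.
apply: fV => k _; set n := maxn N k.
have [_ [[_ h _] _ _]] := hb (heap_index z n); rewrite size_mkseq in h.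
apply: (h v (hv n _) k) (hx n); first exact: leq_maxl.
exact: leq_trans (leq_maxr _ _) (heap_index_ge z n).
Qed.

Lemma nonescaping_depth z : ~ escapes z -> exists m,
  (exists N, forall n, (N <= n)%N -> (m < depth z n)%N) /\
  forall N, exists2 n, (N <= n)%N & depth z n = m.+1.
Proof.
move=> nz.
have [M hM] : exists M, forall N, exists2 n, (N <= n)%N & (depth z n <= M)%N.
  apply: contrapT => h; apply: nz => M; apply: contrapT => hN; apply: h.
  exists M => N; apply: contrapT => hn; apply: hN; exists N => n Nn.
  by rewrite leqNgt; apply/negP => lt; apply: hn; exists n => //; exact: ltnW.
elim: M hM => [|M IH] hM.
  by have [n _] := hM 0%N; have := depth_gt0 z n; case: (depth z n).
case: (pselect (forall N, exists2 n, (N <= n)%N & (depth z n <= M)%N)); first exact: IH.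
move=> /existsNP[N hN].
have hd n : (N <= n)%N -> (M < depth z n)%N.
  by move=> Nn; rewrite ltnNge; apply/negP => le; apply: hN; exists n.
exists M; split; first by exists N.
move=> N'; have [n nn dn] := hM (maxn N N'); exists n.
  by apply: leq_trans nn; exact: leq_maxr.
by apply/eqP; rewrite eqn_leq dn hd //; apply: leq_trans nn; exact: leq_maxl.
Qed.

(** At the lower limit of the depth one node [v] is the head infinitely often. So [x] is in [nHs v],
    where [f] is continuous, and is approximated by stage points whose values avoid all sets opened
    after [v]. *)
Lemma nonescaping_value z x : ~ escapes z -> (forall n, nb (path_stage z n) x) ->
  exists m, forall t, (m <= t)%N -> ~ interior (sV (b t)) (f x).
Proof.
move=> /nonescaping_depth[m [[N hN] hm]] hx.
have [v [c [sc hc]]] := stable_suffix hN.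
have hv n : (N <= n)%N -> depth z n = m.+1 -> ch (path_stage z n) = v :: c.
  move=> /hc[s es] dn; move: es (size_chain z n) => ->; rewrite dn size_cat /= sc.
  by case: s => //= w s; lia.
have Hsx : nHs v x.
  move=> k _; have [n nn dn] := hm (maxn N k).
  have [_ [[_ _ h] _ _]] := hb (heap_index z n); rewrite size_mkseq in h.
  apply: (h v c (hv n _ dn) k) (hx n); first exact: leq_trans (leq_maxl _ _) nn.
  exact: leq_trans (leq_trans (leq_maxr _ _) nn) (heap_index_ge z n).
have cv : cont_on f (nHs v).
  have [n nn dn] := hm N; have [_ _ + _ _] := stage_wf (ltnSn (heap_index z n)).
  by rewrite (hv n nn dn) => -[[[_ _ []]]].
exists (nidx v).+1 => t vt fx.
have [ O [oO Ox hO]] := cv x Hsx _ (open_interior (sV (b t))) fx.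
have [e e0 he] := open_distP hdX oO Ox; have [n0 ne] := small_inv e0.
have [n nn dn] := hm (maxn N n0).
have ec := hv n (leq_trans (leq_maxl _ _) nn) dn.
set i := heap_index z n in ec.
(* Stage [i] is good for every longer list, so its point avoids the set of [t] whichever of the two
   came first. *)
have [il tl] : (i < (maxn i t).+1)%N /\ (t < (maxn i t).+1)%N.
  by rewrite !ltnS leq_maxl leq_maxr.
have [_ nbi _ _] := stage_wf il; rewrite /good_stage ec => -[Hp nav _ _].
apply: nav; exists t; split=> //; rewrite values_mkseq //.
apply: subset_closure; apply: interior_subset; apply: hO => //; apply: he.
have [_ [[h _ _] _ _]] := hb i; rewrite size_mkseq in h.
apply: lt_trans (h x _ (hx n) nbi) (le_lt_trans _ ne).
rewrite lef_pV2 ?posrE // ler_nat ltnS; apply: leq_trans (heap_index_ge z n).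
exact: leq_trans (leq_maxr _ _) nn.
Qed.

Lemma stage_sequence_absurd : (forall A, Gdelta A -> exists P : nat -> set X,
  (forall i, Gdelta (P i)) /\ f @^-1` A = \bigcup_i P i) -> False.
Proof.
move=> hf; have [phi hphi] := choice path_limit.
pose A m := \bigcup_(t in [set t | (m <= t)%N]) interior (sV (b t)).
have [P [gP eP]] : exists P : nat -> set X,
    (forall i, Gdelta (P i)) /\ f @^-1` (\bigcap_m A m) = \bigcup_i P i.
  apply: hf; exists A => // m; apply: bigcup_open => t _; exact: open_interior.
have /choice[U hU] : forall k : nat,
    exists U : nat -> set X, (forall j, open (U j)) /\ P k = \bigcap_j U j.
  by move=> k; have [U] := gP k; exists U.
(* The limit map [phi] is continuous, so it pulls the Sigma^0_3 preimage back to a Sigma^0_3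
   description of [escapes]. *)
apply: (@escapes_not_Sigma3 (fun k j => phi @^-1` U k j)) => [k j z Uz|z].
  have [e e0 he] := open_distP hdX ((hU k).1 j) Uz; have [n ne] := small_inv e0.
  exists n => z' zz'; apply: he.
  have hz' := hphi z' n; rewrite (heap_index_prefix zz') in hz'.
  have [_ [[h _ _] _ _]] := hb (heap_index z n); rewrite size_mkseq in h.
  apply: lt_trans (h _ _ (hphi z n) hz') (le_lt_trans _ ne).
  by rewrite lef_pV2 ?posrE // ler_nat ltnS heap_index_ge.
have -> : (exists k, forall j, (phi @^-1` U k j) z) <-> (\bigcap_m A m) (f (phi z)).
  have -> : (\bigcap_m A m) (f (phi z)) = (\bigcup_i P i) (phi z) by rewrite -eP.
  split=> [[k hk]|[k _]]; first by exists k => //; rewrite (hU k).2 => j _; exact: hk.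
  by rewrite (hU k).2 => hk; exists k => j; exact: hk.
split=> [ez m _|hA].
  by have [t mt ft] := escaping_value ez (hphi z) m; exists t.
apply: contrapT => nz; have [m hm] := nonescaping_value nz (hphi z).
by have [t /= mt ft] := hA m I; exact: hm ft.
Qed.

End Paths.

(** * The equivalence *)

Lemma within_cont_on (X Y : topologicalType) (f : X -> Y) (P : set X) :
  {within P, continuous f} <-> cont_on f P.
Proof.
rewrite subspace_continuousP; split=> [h x Px V oV Vx|h x Px V].
  have hV : nbhs x [set u | P u -> V (f u)].
    exact: h x Px V (open_nbhs_nbhs (conj oV Vx)).
  move: hV; rewrite nbhsE => -[ O [oO Ox] hO].
  by exists O; split=> // u Ou Pu; exact: hO.
rewrite nbhsE => -[W [oW Wx] WV]; have [ O [oO Ox hO]] := h x Px W oW Wx.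
suff : nbhs x [set u | P u -> V (f u)] by [].
rewrite nbhsE; exists O => // u Ou Pu.
exact/WV/hO.
Qed.

Theorem theorem4p7 (R : realType) (X Y : topologicalType)
    (hX : polish R X) (hY : separable_metrizable R Y) (f : X -> Y) :
  (forall A : set Y, Sigma0 3 A -> Sigma0 3 (f @^-1` A)) <->
  dec_Sigma1_Delta 3 f.
Proof.
have [sX [dX hdX cdX]] := hX; have [sY [dY hdY]] := hY.
split=> [hf|[P [cP _ dP fP]] A /(Sigma0_3P hdY)[Q [gQ ->]]].
  have hG A : Gdelta A -> exists P : nat -> set X,
      (forall i, Gdelta (P i)) /\ f @^-1` A = \bigcup_i P i.
    by move=> /(Gdelta_Delta0_3 hdY)[/hf /(Sigma0_3P hdX)].
  have [P [gP cP XP]] : small f setT.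
    apply: contrapT => nX.
    have [BX hBX] := countable_regular_base hdX sX.
    have [BY hBY] := countable_regular_base hdY sY.
    have [b hb] := stage_sequence hdX cdX hdY hBX hBY hG nX.
    exact: (stage_sequence_absurd hdX cdX hb hG).
  exists (seqDU P); split.
  - by rewrite /cover -seqDU_bigcup_eq; apply/seteqP; split.
  - exact: trivIset_seqDU.
  - exact: (Delta0_3_seqDU hdX gP).
  - move=> k; apply/within_cont_on/(cont_onS _ (cP k)) => x.
    by rewrite /seqDU => -[].
have -> : f @^-1` (\bigcup_i Q i) = \bigcup_k \bigcup_i (P k `&` f @^-1` Q i).
  apply/seteqP; split=> x [k _]; last by move=> [i _ [_ Qi]]; exists i.
  have [n _ Pn] : cover [set: nat] P x by rewrite cP.
  by move=> Qk; exists n => //; exists k.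
apply: (Sigma0_3_bigcup hdX) => k; apply: (Sigma0_3_bigcup hdX) => i.
have [U oU eU] := gQ i.
have /choice[W hW] : forall j : nat, exists W : set X,
    open W /\ P k `&` f @^-1` U j = P k `&` W.
  move=> j; have /within_cont_on ck := fP k.
  (* The largest open set whose trace on [P k] is sent into [U j]. *)
  exists (\bigcup_(O in [set O | open O /\ O `&` P k `<=` f @^-1` U j]) O); split.
    by apply: bigcup_open => O [].
  apply/seteqP; split=> x [Px h]; split=> //.
    have [ O [oO Ox hO]] := ck x Px _ (oU j) h; exists O => //; split=> //.
    by move=> u [ Ou Pu]; exact: hO.
  by case: h => O [oO hO] Ox; apply: hO.
have -> : P k `&` f @^-1` Q i = P k `&` \bigcap_j W j.
  rewrite eU; apply/seteqP; split=> x [Px h]; split=> // j _.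
    have : (P k `&` f @^-1` U j) x by split=> //; exact: h.
    by rewrite (hW j).2 => -[].
  have : (P k `&` W j) x by split=> //; exact: h.
  by rewrite -(hW j).2 => -[].
apply: (Sigma0_3I hdX); first by case: (dP k).
apply: (Gdelta_Delta0_3 hdX _).1; exists W => // j; exact: (hW j).1.
Qed.
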